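(* Let $f$ be convex, let $\{x_n\}_{n\ge1}$ be generated by the stochastic mirror descent algorithm described in the context with step-sizes $\alpha_n=\frac1{\sqrt n}$, $n\ge1$, and assume the conditions (B1)–(B5) of the context. Let $x^*$ be a minimizer of $f$ over $\mathcal X$, $f^*=f(x^* )$, $D_1:=\sup_{x\in\mathcal X}\mathbb D_R(x^*,x)$ and $z_n:=\frac{\sum_{k=1}^n\alpha_kx_k}{\sum_{k=1}^n\alpha_k}$. For $\epsilon>0$ and $p\in(0,1)$ let $N(\epsilon,p)$ be the smallest positive integer such that $\mathbb P\big(f(z_n)-f^*\ge\epsilon\big)\le p$ for all $n\ge N(\epsilon,p)$. Then $$N(\epsilon,p)=\tilde{\mathcal O}\left(\frac1{\epsilon^2}\max\left\{D_1^2+\mathbf G^2D^2,\ \frac{\mathbf G^4+\mathbf G^2(1+2L_\Pi D)^2}{\sigma_R^2},\ \mathbf G^2D^2\ln\Big(\frac1p\Big)\right\}\right).$$ Here $\tilde{\mathcal O}$ means: writing $M$ for the expression inside $\tilde{\mathcal O}(\cdot)$, there are absolute constants $c,q>0$ (independent of $\epsilon$, $p$ and all problem data) such that $N(\epsilon,p)\le c\,(1+M)\,\big(\ln(2+M)\big)^q$.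
   Context: Setting. $\mathcal X\subseteq\mathbb R^d$ is compact and convex with diameter $D=\sup_{x,y\in\mathcal X}\|x-y\|$; $\mathbb R^d$ carries a norm $\|\cdot\|$ with dual norm $\|\cdot\|_*$; $\mathcal S$ is a topological space with its Borel $\sigma$-algebra. For each $x\in\mathcal X$, $\Pi(x,\cdot)$ is a Markov transition kernel on $\mathcal S$ (for $s\in\mathcal S$, $\Pi(x,s)$ is a probability measure on $\mathcal S$) that is ergodic with unique stationary distribution $\mu_x$. The objective is $f(x)=\int_{\mathcal S}F(x,s)\,d\mu_x(s)$. $\mathbb D_R(x,y)=R(x)-R(y)-\langle\nabla R(y),x-y\rangle$ is the Bregman divergence of the mirror map $R$. Algorithm. With step-sizes $\alpha_n$, a given initial point $x_1\in\mathcal X$ and an initial state $S_1$, $$x_{n+1}=\arg\min_{x\in\mathcal X}\Big\{\langle G(x_n,S_n),x\rangle+\tfrac1{\alpha_n}\mathbb D_R(x,x_n)\Big\},$$ and, conditionally on $\mathcal F_n=\sigma(x_k,S_k:k\le n)$, $S_{n+1}$ has law $\Pi(x_n,S_n)$. Assumptions. (B1) $R:\mathbb R^d\to\mathbb R$ is twice continuously differentiable and $\sigma_R$-strongly convex with respect to $\|\cdot\|$. (B2) $f$ is continuously differentiable with $\|\nabla f(x)-\nabla f(y)\|_*\le L\|x-y\|$ for $x,y\in\mathcal X$. (B3) $G:\mathcal X\times\mathcal S\to\mathbb R^d$ is measurable, $\|G(x,s)\|_*\le\mathbf G$ for all $(x,s)$, and $\nabla f(x)=\int_{\mathcal S}G(x,s')\mu_x(ds')$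 for all $x\in\mathcal X$. (B4) (Poisson equation) There is a Borel measurable $\widetilde G:\mathcal X\times\mathcal S\to\mathbb R^d$ with $G(x,s)-\int_{\mathcal S}G(x,s')\mu_x(ds')=\widetilde G(x,s)-(\Pi\widetilde G)(x,s)$, where $(\Pi\widetilde G)(x,s)=\int_{\mathcal S}\widetilde G(x,s')\Pi(x,s)(ds')$, and $\sup_{x,s}\|\widetilde G(x,s)\|_*\le\mathbf G$. (B5) There is $L_\Pi>0$ with $\|\widetilde G(x_1,s)-\widetilde G(x_2,s)\|_*\le L_\Pi\|x_1-x_2\|$ for all $x_1,x_2\in\mathcal X$, $s\in\mathcal S$. *)

(* Defs.v *)
From HB Require Import structures.
From mathcomp Require Export all_boot all_order all_algebra.
From mathcomp Require Export all_classical all_reals all_analysis.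
From mathcomp Require Export measurable_realfun.
Export Order.TTheory GRing.Theory Num.Theory.
Export numFieldNormedType.Exports.

Set Implicit Arguments.
Unset Strict Implicit.
Unset Printing Implicit Defensive.

#[export] Set Implicit Arguments.
#[export] Unset Strict Implicit.
#[export] Unset Printing Implicit Defensive.

#[global] Open Scope classical_set_scope.
#[global] Open Scope ring_scope.

(* The type T equipped with its Borel sigma-algebra. *)
Notation borelType T := (g_sigma_algebraType (@open T)).

Section euclidean.
Context {R : realType} {d : nat}.
Implicit Types (u v x y : 'rV[R]_d) (f : 'rV[R]_d -> R) (X : set 'rV[R]_d).

Definition dot u v : R := \sum_(i < d) u 0 i * v 0 i.

Definition grad f x : 'rV[R]_d := \row_(i < d) 'D_(delta_mx 0 i) f x.

(* An arbitrary norm on R^d. The topology, differentiability and Borel sets of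
   'rV[R]_d are the library's ones, built on the maximum norm; all norms on
   R^d induce them. *)
Definition is_norm (N : 'rV[R]_d -> R) : Prop :=
  [/\ forall x, 0 <= N x,
      forall x, N x = 0 -> x = 0,
      forall (a : R) x, N (a *: x) = `|a| * N x
    & forall x y, N (x + y) <= N x + N y].

Definition dual_norm (N : 'rV[R]_d -> R) u : R :=
  sup [set dot u x | x in [set x | N x <= 1]].

Definition diameter (N : 'rV[R]_d -> R) X : R :=
  sup [set N (x - y) | x in X & y in X].

(* The derivative of [grad f] is the Hessian of [f]. *)
Definition twice_continuously_differentiable f : Prop :=
  [/\ forall x, differentiable f x,
      forall x, differentiable (grad f) x
    & continuous (jacobian (grad f))].

(* On X, with the differential taken in the ambient space R^d. *)
Definition continuously_differentiable_on X f : Prop :=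
  (forall x, X x -> differentiable f x) /\ {within X, continuous (grad f)}.

Definition strongly_convex (N : 'rV[R]_d -> R) (sigma : R) f : Prop :=
  0 < sigma /\
  forall x y (t : R), 0 <= t <= 1 ->
    f (t *: x + (1 - t) *: y) <=
      t * f x + (1 - t) * f y - sigma / 2 * t * (1 - t) * N (x - y) ^+ 2.

Definition bregman f x y : R := f x - f y - dot (grad f y) (x - y).

Definition is_argmin X f x : Prop := X x /\ forall y, X y -> f x <= f y.

Definition vintegral {disp} {T : measurableType disp}
    (mu : {measure set T -> \bar R}) (h : T -> 'rV[R]_d) : 'rV[R]_d :=
  \row_(i < d) \int[mu]_s h s 0 i.

End euclidean.

Section markov.
Context {R : realType} {disp : measure_display} {S : measurableType disp}.
Implicit Types (K : R.-pker S ~> S) (nu : probability S R).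

Definition stationary K nu : Prop :=
  forall A, measurable A -> (\int[nu]_s K s A)%E = nu A.

Definition ergodic K nu : Prop :=
  forall A, measurable A ->
    {ae nu, forall s, K s A = (\1_A s)%:E} ->
    nu A = 0%E \/ nu A = 1%E.

Definition ergodic_unique_stationary K nu : Prop :=
  [/\ stationary K nu, ergodic K nu
    & forall nu' : probability S R, stationary K nu' ->
        forall A, measurable A -> nu' A = nu A].

End markov.

Section process.
Context {R : realType} {dO dE dS : measure_display}
  {Omega : measurableType dO} {E : measurableType dE} {S : measurableType dS}
  (P : probability Omega R).

(* A family of events generating sigma(x_k, S_k : 1 <= k <= n). *)
Definition history_gen (x : nat -> Omega -> E) (s : nat -> Omega -> S)
    (n : nat) : set (set Omega) :=
  \bigcup_(k in [set k | (1 <= k <= n)%N])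
    (preimage_set_system setT (x k) measurable `|`
     preimage_set_system setT (s k) measurable).

(* Conditionally on the sigma-algebra generated by H, the law of Y is the
   random measure Q: for every measurable A, the variable Q _ A is a version
   of the conditional probability P(Y \in A | H). *)
Definition conditional_law (H : set (set Omega)) (Y : Omega -> S)
    (Q : Omega -> {measure set S -> \bar R}) : Prop :=
  forall A, measurable A ->
    measurable_fun setT (fun w : g_sigma_algebraType H => Q w A)
    /\ forall B, <<s H >> B ->
         P (B `&` Y @^-1` A) = (\int[P]_(w in B) Q w A)%E.

End process.

Section mirror_descent.
Context {R : realType} {d : nat} {S : ptopologicalType}
  {dO : measure_display} {Omega : measurableType dO} (P : probability Omega R).

(* As 'rV[R]_d is second countable, the product of the two Borel sigma-algebras
   is the Borel sigma-algebra of the product space. *)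
Definition jointly_measurable_on (X : set 'rV[R]_d)
    (G : 'rV[R]_d -> S -> 'rV[R]_d) : Prop :=
  measurable_fun
    (X `*` setT : set (borelType 'rV[R]_d * borelType S))
    (fun u : borelType 'rV[R]_d * borelType S =>
       G u.1 u.2 : borelType 'rV[R]_d).

(* Indices start at 1: the values at index 0 are irrelevant. *)
Definition stochastic_mirror_descent
    (X : set 'rV[R]_d) (mirror : 'rV[R]_d -> R)
    (G : 'rV[R]_d -> S -> 'rV[R]_d)
    (Pi : 'rV[R]_d -> R.-pker borelType S ~> borelType S)
    (alpha : nat -> R) (x1 : 'rV[R]_d)
    (x : nat -> {RV P >-> borelType 'rV[R]_d})
    (s : nat -> {RV P >-> borelType S}) : Prop :=
  [/\ X x1, forall w, x 1%N w = x1,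
      forall n w, (1 <= n)%N ->
        is_argmin X
          (fun y => dot (G (x n w) (s n w)) y
                    + (alpha n)^-1 * bregman mirror y (x n w))
          (x n.+1 w)
    & forall n, (1 <= n)%N ->
        conditional_law P (history_gen x s n) (s n.+1)
          (fun w => Pi (x n w) (s n w))].

Definition weighted_average (alpha : nat -> R)
    (x : nat -> Omega -> 'rV[R]_d) (n : nat) (w : Omega) : 'rV[R]_d :=
  (\sum_(1 <= k < n.+1) alpha k)^-1 *: \sum_(1 <= k < n.+1) alpha k *: x k w.

End mirror_descent.

(* N is the smallest positive integer such that Q n holds for all n >= N. *)
Definition is_least_threshold (Q : nat -> Prop) (N : nat) : Prop :=
  [/\ (0 < N)%N, forall n, (N <= n)%N -> Q n
    & forall m, (0 < m)%N -> (forall n, (m <= n)%N -> Q n) -> (N <= m)%N].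

(* Main.v *)
(* Writing [grad f (x_k) = G (x_k, S_k) - (Gt - Pi Gt) (x_k, S_k)] by the Poisson
   equation, the weighted sum of the [<grad f (x_k), x_k - xstar>] splits into the
   mirror-descent regret, a telescoping sum of values of [Gt] (summed by parts and
   controlled by the Lipschitz constant of [Gt] and the step length
   [|x_(k+1) - x_k| <= alpha_k GG / sigmaR]), and a martingale with increments bounded
   by [2 GG D alpha_k]. As [sum alpha_k >= sqrt n] and [sum alpha_k ^ 2 <= 1 + ln n],
   convexity and an Azuma-Hoeffding bound give the tail estimate as soon as
   [256 (1 + M) (1 + ln n) ^ 2 <= n]. *)
From HB Require Import structures.
Require Import Defs.
From mathcomp Require Import ring lra.

(** * Norms, gradients and mirror steps *)

(** The states are dependent, so [G (x_k, S_k) - grad f (x_k)] has no zero conditional mean.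
    Comparing [Gt (x_k, S_(k+1))] with its average under [Pi (x_k, S_k)] does give a centred
    difference, since that kernel is the conditional law of [S_(k+1)]; everything else in the
    Poisson correction is bounded pathwise.

    The state space is an arbitrary topological space, where regular conditional probabilities may
    fail to exist. The kernel given by the algorithm takes their place, and integrals are
    disintegrated along it starting from its defining identity on events.

    The constant 256 comes from sharing out [eps * sqrt n]. Half goes to the martingale. The other
    half pays for four deterministic summands, [eps * sqrt n / 8] each; for the summand [2 C D] this
    asks [4 * 64 * C^2 D^2 <= eps^2 n], the most demanding of the conditions. *)

Section norms.
Context {R : realType} {d : nat}.
Implicit Types (u v x y z : 'rV[R]_d) (f : 'rV[R]_d -> R) (X : set 'rV[R]_d).

Lemma dotDl u v x : dot (u + v) x = dot u x + dot v x.
Proof. by rewrite /dot -big_split; apply: eq_bigr => i _; rewrite mxE mulrDl. Qed.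

Lemma dotDr u v x : dot x (u + v) = dot x u + dot x v.
Proof. by rewrite /dot -big_split; apply: eq_bigr => i _; rewrite mxE mulrDr. Qed.

Lemma dotZl (a : R) u x : dot (a *: u) x = a * dot u x.
Proof. by rewrite /dot mulr_sumr; apply: eq_bigr => i _; rewrite mxE mulrA. Qed.

Lemma dotZr (a : R) u x : dot x (a *: u) = a * dot x u.
Proof. by rewrite /dot mulr_sumr; apply: eq_bigr => i _; rewrite mxE mulrCA. Qed.

Lemma dotNl u x : dot (- u) x = - dot u x.
Proof. by rewrite -scaleN1r dotZl mulN1r. Qed.

Lemma dotNr u x : dot x (- u) = - dot x u.
Proof. by rewrite -scaleN1r dotZr mulN1r. Qed.

Lemma dotBl u v x : dot (u - v) x = dot u x - dot v x.
Proof. by rewrite dotDl dotNl. Qed.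

Lemma dot0r x : dot x 0 = 0.
Proof. by rewrite -(scale0r x) dotZr mul0r. Qed.

Lemma dot_delta x (i : 'I_d) : dot x (delta_mx 0 i) = x 0 i.
Proof.
rewrite /dot (bigD1 i)//= big1 ?addr0; last first.
  by move=> j ji; rewrite mxE (negbTE ji) andbF mulr0.
by rewrite mxE !eqxx mulr1.
Qed.

Lemma coord_le_norm x (i : 'I_d) : `|x 0 i| <= `|x|.
Proof.
rewrite [X in _ <= X]/Num.norm/= mx_normrE.
exact: (le_bigmax _ (fun ij : 'I_1 * 'I_d => `|x ij.1 ij.2|) (0, i)).
Qed.

Context (N : 'rV[R]_d -> R) (HN : is_norm N).

Let N_ge0 x : 0 <= N x. Proof. by case: HN. Qed.
Let N_eq0 x : N x = 0 -> x = 0. Proof. by case: HN => _ + _ _; exact. Qed.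
Let NZ (a : R) x : N (a *: x) = `|a| * N x. Proof. by case: HN. Qed.
Let ND x y : N (x + y) <= N x + N y. Proof. by case: HN. Qed.

Lemma is_norm0 : N 0 = 0.
Proof. by rewrite -(scale0r 0) NZ normr0 mul0r. Qed.

Lemma is_normN x : N (- x) = N x.
Proof. by rewrite -scaleN1r NZ normrN1 mul1r. Qed.

Lemma is_normB x y : N (x - y) = N (y - x).
Proof. by rewrite -is_normN opprB. Qed.

Lemma is_norm_le_mx : exists2 C, 0 <= C & forall x, N x <= C * `|x|.
Proof.
exists (\sum_(i < d) N (delta_mx 0 i)); first exact: sumr_ge0.
move=> x; rewrite [X in N X]row_sum_delta mulr_suml.
elim/big_ind2 : _ => [|a b a' b' ab ab'|i _].
- by rewrite is_norm0.
- by rewrite (le_trans (ND _ _))// lerD.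
- by rewrite NZ mulrC ler_wpM2l// coord_le_norm.
Qed.

Lemma is_norm_continuous : continuous N.
Proof.
have [C C0 NC] := is_norm_le_mx.
have Nlip x y : `|N x - N y| <= C * `|x - y|.
  rewrite ler_norml; apply/andP; split.
    rewrite lerNl opprB lerBlDl.
    rewrite -[X in N X <= _](subrK x) addrC (le_trans (ND _ _))// lerD2l.
    by rewrite -normrN opprB.
  by rewrite lerBlDl -[X in N X <= _](subrK y) addrC (le_trans (ND _ _))// lerD2l.
move=> x; apply/(@cvgrPdist_lt _ _ _ _ (nbhs_filter x)) => e e0.
have D0 : 0 < C + 1 by rewrite ltr_wpDl.
have := nbhsx_ballx x (e / (C + 1)) (divr_gt0 e0 D0).
apply: filterS => y; rewrite -ball_normE/= ltr_pdivlMr// mulrC => xy.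
rewrite (le_lt_trans (Nlip _ _))// (le_lt_trans _ xy)//.
by rewrite ler_wpM2r// lerDl.
Qed.

(** The constant is the inverse of the minimum of [N] on the unit sphere of the maximum norm, which
    is compact. This half of the equivalence of norms is what bounds the set defining the dual
    norm. *)
Lemma mx_le_is_norm : exists2 C, 0 <= C & forall x, `|x| <= C * N x.
Proof.
pose K := [set x : 'rV[R]_d | `|x| = 1].
(* The sphere is empty exactly when [d = 0]; the extreme value theorem needs a point in it. *)
have [K0|/set0P K0] := eqVneq K set0.
  exists 0 => // x; rewrite mul0r; have [->|x0] := eqVneq x 0.
    by rewrite normr0.
  have : K (`|x|^-1 *: x).
    by rewrite /K/= normrZ ger0_norm ?invr_ge0// mulVf ?normr_eq0.
  by rewrite K0.
have cK : compact K.
  apply: bounded_closed_compact.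
    by exists 1; split => // y y1 x /= ->; exact: ltW.
  rewrite (_ : K = (fun x : 'rV[R]_d => `|x|) @^-1` [set 1])//.
  by apply: preimage_closed => [x _|]; [exact: norm_continuous|exact: closed_eq].
have [c cK' cmin] := compact_EVT_min K0 cK (continuous_subspaceT is_norm_continuous).
have c1 : `|c| = 1 by move: cK'; rewrite inE.
have Nc0 : 0 < N c.
  rewrite lt_neqAle N_ge0 andbT eq_sym; apply/eqP => /N_eq0 c0.
  by move: c1; rewrite c0 normr0 => /eqP; rewrite eq_sym oner_eq0.
exists (N c)^-1; first by rewrite invr_ge0.
move=> x; have [->|x0] := eqVneq x 0; first by rewrite normr0 mulr_ge0// invr_ge0.
have xn : 0 < `|x| by rewrite normr_gt0.
rewrite mulrC ler_pdivlMr// mulrC -ler_pdivlMr//.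
have := cmin (`|x|^-1 *: x); rewrite inE => /(_ _).
rewrite NZ ger0_norm ?invr_ge0// mulrC; apply.
by rewrite /K/= normrZ ger0_norm ?invr_ge0// mulVf ?normr_eq0.
Qed.

(** [sup] has a junk value on sets that are empty or unbounded, so this precedes any use of
    [dual_norm]. *)
Lemma dual_norm_has_sup u : has_sup [set dot u x | x in [set x | N x <= 1]].
Proof.
split; first by exists (dot u 0), 0 => //=; rewrite is_norm0.
have [C C0 NC] := mx_le_is_norm.
exists (\sum_(i < d) `|u 0 i| * C) => _ [x /= Nx <-]; apply: ler_sum => i _.
rewrite (le_trans (ler_norm _))// normrM ler_wpM2l//.
rewrite (le_trans (coord_le_norm _ _))// (le_trans (NC x))//.
by rewrite ler_piMr.
Qed.

Lemma dot_le_dual_norm u x : dot u x <= dual_norm N u * N x.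
Proof.
have [->|x0] := eqVneq x 0; first by rewrite dot0r is_norm0 mulr0.
have Nx0 : 0 < N x.
  by rewrite lt_neqAle N_ge0 andbT eq_sym; apply/eqP => /N_eq0/eqP; exact/negP.
rewrite -ler_pdivrMr// mulrC -dotZr.
apply: ub_le_sup; first by case: (dual_norm_has_sup u).
exists ((N x)^-1 *: x) => //=.
by rewrite NZ ger0_norm ?invr_ge0// mulVf ?gt_eqF.
Qed.

Lemma dual_norm_ge0 u : 0 <= dual_norm N u.
Proof.
apply: ub_le_sup; first by case: (dual_norm_has_sup u).
by exists 0; rewrite ?dot0r//= is_norm0.
Qed.

Lemma abs_dot_le_dual_norm u x : `|dot u x| <= dual_norm N u * N x.
Proof.
rewrite ler_norml dot_le_dual_norm andbT lerNl -dotNr -[N x]is_normN.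
exact: dot_le_dual_norm.
Qed.

Lemma coord_le_dual_norm u (i : 'I_d) : `|u 0 i| <= dual_norm N u * N (delta_mx 0 i).
Proof. by rewrite -dot_delta abs_dot_le_dual_norm. Qed.

Lemma compact_is_norm_bounded X : compact X -> exists M, forall x, X x -> N x <= M.
Proof.
move=> /compact_bounded[M [_ MX]]; have [C C0 NC] := is_norm_le_mx.
exists (C * (M + 1)) => x Xx; rewrite (le_trans (NC x))// ler_wpM2l//.
by apply: MX => //; rewrite ltrDl.
Qed.

Lemma is_norm_le_diameter X x y : compact X -> X x -> X y ->
  N (x - y) <= diameter N X.
Proof.
move=> /compact_is_norm_bounded[M MX] Xx Xy.
rewrite /diameter; apply: ub_le_sup; last first.
  exists x; first exact: Xx.
  by exists y.
exists (M + M) => _ [a Xa [b Xb <-]].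
by rewrite (le_trans (ND _ _))// is_normN lerD// MX.
Qed.

End norms.

(** * First-order inequalities for convex and strongly convex functions *)

Section gradients.
Context {R : realType} {d : nat}.
Implicit Types (u v x y z : 'rV[R]_d) (f : 'rV[R]_d -> R) (X : set 'rV[R]_d).

Lemma derive_dot_grad f x v : differentiable f x -> 'D_v f x = dot (grad f x) v.
Proof.
move=> df; rewrite deriveE// [in LHS](row_sum_delta v) linear_sum.
apply: eq_bigr => i _; rewrite linearZ mxE deriveE//= mulrC.
by rewrite /GRing.scale/= mulrC.
Qed.

Let segment_quotient_cvg f x v : differentiable f x ->
  h^-1 * (f (x + h *: v) - f x) @[h --> 0^'+] --> dot (grad f x) v.
Proof.
move=> df; rewrite -derive_dot_grad//; apply: cvg_dnbhs_at_right.
have /cvg_ex[l lP] := diff_derivable (v := v) df.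
rewrite /derive (cvg_lim _ lP)//.
rewrite (_ : (fun h : R => _) =
  (fun h => h^-1 *: ((f \o shift x) (h *: v) - f x)))//.
by apply/funext => h /=; rewrite [x + _]addrC.
Qed.

(** Divide by [t] and let [t] decrease to 0. The term [b * t] leaves room for the factor [1 - t] of
    strong convexity; plain convexity takes [b = 0]. *)
Lemma dot_grad_le f x v (a b : R) : differentiable f x ->
  (forall t, 0 < t <= 1 -> f (x + t *: v) - f x <= t * (a + b * t)) ->
  dot (grad f x) v <= a.
Proof.
move=> df fab.
have ab : a + b * h @[h --> 0^'+] --> a.
  rewrite -[X in _ --> X]addr0; apply: cvgD; first exact: cvg_cst.
  rewrite -[X in _ --> X](mulr0 b); apply: cvgM; first exact: cvg_cst.
  exact: cvg_within.
apply: (ler_cvg_to (segment_quotient_cvg (v := v) df) ab).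
near=> h; have h0 : 0 < h by [].
rewrite mulrC ler_pdivrMr// mulrC fab// h0/=.
by near: h; exact: nbhs_right_le.
Unshelve. all: by end_near. Qed.

Lemma dot_grad_ge f x v (a : R) : differentiable f x ->
  (forall t, 0 < t <= 1 -> t * a <= f (x + t *: v) - f x) ->
  a <= dot (grad f x) v.
Proof.
move=> df fa.
apply: (cvgr_to_ge (segment_quotient_cvg (v := v) df)).
near=> h; have h0 : 0 < h by [].
rewrite [leRHS]mulrC ler_pdivlMr// mulrC fa// h0/=.
by near: h; exact: nbhs_right_le.
Unshelve. all: by end_near. Qed.

Lemma segmentE x y (t : R) : x + t *: (y - x) = t *: y + (1 - t) *: x.
Proof. by rewrite scalerBr scalerBl scale1r addrCA addrA. Qed.

Lemma convex_set_segment X x y (t : R) : convex_set X -> X x -> X y ->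
  0 <= t <= 1 -> X (t *: x + (1 - t) *: y).
Proof.
move=> cX Xx Xy t01.
have := cX x y (Itv01 (andP t01).1 (andP t01).2).
by rewrite !inE => /(_ Xx Xy).
Qed.

Lemma convex_function_segment X f x y (t : R) : convex_function X f -> X x -> X y ->
  0 <= t <= 1 -> f (t *: x + (1 - t) *: y) <= t * f x + (1 - t) * f y.
Proof.
move=> cf Xx Xy t01.
by have := cf (Itv01 (andP t01).1 (andP t01).2) x y; rewrite !inE => /(_ Xx Xy).
Qed.

Lemma convex_gradient_le X f x y : convex_function X f -> X x -> X y ->
  differentiable f x -> dot (grad f x) (y - x) <= f y - f x.
Proof.
move=> cf Xx Xy df; apply: (@dot_grad_le _ _ _ _ 0) => // t /andP[t0 t1].
have := convex_function_segment cf Xy Xx (t := t); rewrite (ltW t0) t1 => /(_ isT).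
by rewrite segmentE; lra.
Qed.

Lemma strongly_convex_bregman_ge (N : 'rV[R]_d -> R) (sigma : R) f x y :
  strongly_convex N sigma f -> differentiable f y ->
  sigma / 2 * N (x - y) ^+ 2 <= bregman f x y.
Proof.
move=> [s0 scf] df; rewrite /bregman lerBrDr -lerBrDl.
apply: (@dot_grad_le _ _ _ _ (sigma / 2 * N (x - y) ^+ 2)) => // t /andP[t0 t1].
have := scf x y t; rewrite (ltW t0) t1 => /(_ isT).
by rewrite segmentE; lra.
Qed.

End gradients.

(** * The mirror step and the pathwise regret bound *)

Section mirror_step.
Context {R : realType} {d : nat}.
Implicit Types (x y g : 'rV[R]_d) (f : 'rV[R]_d -> R) (X : set 'rV[R]_d).

(** Minimality along the segment from [x'] to [y] gives, in the limit, the variational inequality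
    [H]: the pairing of [a g + grad f x' - grad f x] with [y - x'] is nonnegative. The three Bregman
    terms are the three-point identity. *)
Lemma argmin_bregman X f g x x' y (a : R) : convex_set X ->
  (forall z, differentiable f z) -> 0 < a ->
  is_argmin X (fun z => dot g z + a^-1 * bregman f z x) x' -> X y ->
  a * dot g (x' - y) <= bregman f y x - bregman f y x' - bregman f x' x.
Proof.
move=> cX df a0 [Xx' x'min] Xy.
have H : dot (grad f x) (y - x') - a * dot g (y - x') <= dot (grad f x') (y - x').
  apply: dot_grad_ge => // t /andP[t0 t1].
  have := x'min (x' + t *: (y - x')).
  rewrite {1}segmentE => /(_ _)/wrap[].
    by apply: convex_set_segment => //; rewrite (ltW t0).
  move=> h; rewrite -(ler_pM2l a0) !mulrDr !mulrA mulfV ?gt_eqF// !mul1r /bregman in h.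
  move: h;
  rewrite !(dotDr, dotZr, dotNr); lra.
move: H; rewrite /bregman !(dotDr, dotZr, dotNr); lra.
Qed.

Context (N : 'rV[R]_d -> R) (HN : is_norm N).

(** Optimality tested at [y = x] produces both [bregman f x x'] and [bregman f x' x]; each is at
    least [sigma / 2 * N (x' - x) ^+ 2], so no factor 2 is lost. *)
Lemma mirror_step_norm_le X f g x x' (a sigma C : R) : convex_set X ->
  strongly_convex N sigma f -> (forall z, differentiable f z) -> 0 < a ->
  is_argmin X (fun z => dot g z + a^-1 * bregman f z x) x' -> X x ->
  dual_norm N g <= C ->
  sigma * N (x' - x) <= a * C.
Proof.
move=> cX sf df a0 x'min Xx gC.
have N0 : 0 <= N (x' - x) by case: HN.
have s0 : 0 < sigma by case: sf.
have := argmin_bregman cX df a0 x'min Xx.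
rewrite {1}/bregman !subrr dot0r subr0.
have := strongly_convex_bregman_ge x sf (df x').
have := strongly_convex_bregman_ge x' sf (df x).
rewrite (is_normB HN x x') => h1 h2 h3.
have h4 : dot g (x - x') <= C * N (x' - x).
  rewrite (le_trans (dot_le_dual_norm HN _ _))// (is_normB HN) ler_wpM2r//.
have h5 : dot g (x' - x) = - dot g (x - x') by rewrite -dotNr opprB.
have h6 : sigma * N (x' - x) * N (x' - x) <= a * C * N (x' - x).
  have : a * dot g (x - x') <= a * (C * N (x' - x)) by rewrite ler_pM2l.
  rewrite h5 in h3; lra.
have [Nx|Nx] := eqVneq (N (x' - x)) 0.
  rewrite Nx mulr0 mulr_ge0 ?(ltW a0)//.
  exact: le_trans (dual_norm_ge0 HN g) gC.
by move: h6; rewrite ler_pM2r// lt_neqAle eq_sym Nx.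
Qed.

(** Split [x - y] at [x']. Optimality handles [x' - y] and leaves [- bregman f x' x], which absorbs
    the cost [a C N (x' - x)] of the other half by completing a square. *)
Lemma mirror_step_le X f g x x' y (a sigma C : R) : convex_set X ->
  strongly_convex N sigma f -> (forall z, differentiable f z) -> 0 < a ->
  is_argmin X (fun z => dot g z + a^-1 * bregman f z x) x' -> X y ->
  dual_norm N g <= C ->
  a * dot g (x - y) <=
    bregman f y x - bregman f y x' + a ^+ 2 * (C ^+ 2 / (2 * sigma)).
Proof.
move=> cX sf df a0 x'min Xy gC.
have N0 : 0 <= N (x' - x) by case: HN.
have s0 : 0 < sigma by case: sf.
have h1 := argmin_bregman cX df a0 x'min Xy.
have h2 := strongly_convex_bregman_ge x' sf (df x).
have h4 : a * dot g (x - x') <= a * (C * N (x' - x)).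
  rewrite ler_pM2l// (le_trans (dot_le_dual_norm HN _ _))// (is_normB HN).
  by rewrite ler_wpM2r.
have -> : dot g (x - y) = dot g (x - x') + dot g (x' - y).
  by rewrite -dotDr addrA subrK.
suff : a * (C * N (x' - x)) - sigma / 2 * N (x' - x) ^+ 2 <=
    a ^+ 2 * (C ^+ 2 / (2 * sigma)) by lra.
rewrite -subr_ge0.
rewrite (_ : _ - _ = (a * C - sigma * N (x' - x)) ^+ 2 / (2 * sigma)); last first.
  by field; rewrite gt_eqF.
by rewrite divr_ge0 ?sqr_ge0// mulr_ge0// ltW.
Qed.

(* The Poisson correction [u - w] is split into a telescoping part, summed by
   parts, and a part controlled by the Lipschitz constant [K] of the solution. *)
Lemma mirror_descent_sum_le X f (x g u w gr xi : nat -> 'rV[R]_d)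
    (xs : 'rV[R]_d) (alpha : nat -> R) (sigma C K : R) (n : nat) :
  let D := diameter N X in
  compact X -> convex_set X -> strongly_convex N sigma f ->
  (forall z, differentiable f z) ->
  (forall k, (1 <= k)%N -> 0 < alpha k) ->
  (forall k, (1 <= k)%N -> alpha k.+1 <= alpha k) ->
  (forall k, (1 <= k)%N -> X (x k)) -> X xs -> 0 <= K ->
  (forall k, (1 <= k)%N ->
     is_argmin X (fun z => dot (g k) z + (alpha k)^-1 * bregman f z (x k)) (x k.+1)) ->
  (forall k, (1 <= k)%N -> dual_norm N (g k) <= C) ->
  (forall k, (1 <= k)%N -> dual_norm N (u k) <= C) ->
  (forall k, (1 <= k)%N -> dual_norm N (u k.+1 - w k) <= K * N (x k.+1 - x k)) ->
  (forall k, (1 <= k)%N -> xi k = w k - u k + g k - gr k) ->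
  (1 <= n)%N ->
  \sum_(1 <= k < n.+1) alpha k * dot (gr k) (x k - xs) <=
    bregman f xs (x 1%N) + 2 * C * D * alpha 1%N
    + (3 / 2 * (C ^+ 2 / sigma) + K * C * D / sigma) * (\sum_(1 <= k < n.+1) alpha k ^+ 2)
    + \sum_(1 <= k < n.+1) alpha k * dot (xi k) (xs - x k).
Proof.
move=> D cmX cX sf df a0 amono Xx Xxs K0 xmin gC uC Lip xiE n1.
have s0 : 0 < sigma by case: sf.
have N0 y : 0 <= N y by case: HN.
have C0 : 0 <= C by exact: le_trans (dual_norm_ge0 HN (g 1%N)) (gC _ _).
have ND k : (1 <= k)%N -> N (xs - x k) <= D.
  by move=> k1; apply: is_norm_le_diameter => //; exact: Xx.
have D0 : 0 <= D by apply: le_trans (ND 1%N isT).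
have step k : (1 <= k)%N -> N (x k.+1 - x k) <= alpha k * (C / sigma).
  move=> k1; rewrite mulrA ler_pdivlMr// mulrC.
  exact: mirror_step_norm_le (a0 _ k1) (xmin _ k1) (Xx _ k1) (gC _ k1).
have dotC (v y : 'rV[R]_d) (c e : R) : dual_norm N v <= c -> N y <= e ->
    `|dot v y| <= c * e.
  move=> vc ye; rewrite (le_trans (abs_dot_le_dual_norm HN _ _))//.
  by rewrite ler_pM// dual_norm_ge0.
(* The induction needs the exact boundary terms: the last Bregman divergence, the last term of the
   summation by parts, and [alpha n] in [2 * alpha 1 - alpha n], which records the step-size
   changes. The coefficient [3 / 2] is [1 / 2] from the mirror steps plus 1 from the displacements
   of the iterates, whose sum stops at [n - 1]. *)
suff : \sum_(1 <= k < n.+1) alpha k * dot (gr k) (x k - xs) <=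
    bregman f xs (x 1%N) - bregman f xs (x n.+1)
    + C * D * (2 * alpha 1%N - alpha n) - alpha n * dot (u n.+1) (xs - x n)
    + (1 / 2 * (C ^+ 2 / sigma) + K * C * D / sigma) * (\sum_(1 <= k < n.+1) alpha k ^+ 2)
    + C ^+ 2 / sigma * (\sum_(1 <= k < n) alpha k ^+ 2)
    + \sum_(1 <= k < n.+1) alpha k * dot (xi k) (xs - x k).
  have h1 : - (C * D) <= dot (u n.+1) (xs - x n).
    by have := dotC _ _ _ _ (uC n.+1 isT) (ND _ n1); rewrite ler_norml => /andP[].
  have h2 := strongly_convex_bregman_ge xs sf (df (x n.+1)).
  have h3 : 0 <= sigma / 2 * N (xs - x n.+1) ^+ 2.
    by rewrite mulr_ge0// ?exprn_ge0// divr_ge0// ltW.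
  have h4 : - (C * D) * alpha n <= alpha n * dot (u n.+1) (xs - x n).
    by rewrite mulrC ler_pM2l// a0.
  have h5 : C ^+ 2 / sigma * (\sum_(1 <= k < n) alpha k ^+ 2) <=
      C ^+ 2 / sigma * (\sum_(1 <= k < n.+1) alpha k ^+ 2).
    rewrite ler_wpM2l ?divr_ge0 ?sqr_ge0 ?(ltW s0)//.
    by rewrite (big_nat_recr n)//= lerDl sqr_ge0.
  lra.
have one k : (1 <= k)%N -> alpha k * dot (gr k) (x k - xs) <=
    bregman f xs (x k) - bregman f xs (x k.+1)
    + alpha k * dot (u k - u k.+1) (xs - x k)
    + (1 / 2 * (C ^+ 2 / sigma) + K * C * D / sigma) * alpha k ^+ 2
    + alpha k * dot (xi k) (xs - x k).
  move=> k1.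
  have h1 := mirror_step_le cX sf df (a0 _ k1) (xmin _ k1) Xxs (gC _ k1).
  have h2 : alpha k * dot (u k.+1 - w k) (xs - x k) <=
      K * C * D / sigma * alpha k ^+ 2.
    rewrite expr2 mulrA [leRHS]mulrC ler_pM2l ?a0//.
    rewrite (le_trans (ler_norm _))//.
    rewrite (le_trans (dotC _ _ _ _ (Lip _ k1) (ND _ k1)))//.
    have -> : K * C * D / sigma * alpha k = (K * (alpha k * (C / sigma))) * D by ring.
    by rewrite ler_wpM2r// ler_wpM2l// step.
  have -> : gr k = g k + (w k - u k.+1) + (u k.+1 - u k) - xi k.
    rewrite xiE//; rewrite !opprD !opprK !addrA.
    by apply/rowP => i; rewrite !mxE; ring.
  have h3 : alpha k ^+ 2 * (C ^+ 2 / (2 * sigma)) = 1 / 2 * (C ^+ 2 / sigma) * alpha k ^+ 2.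
    by field; rewrite gt_eqF.
  rewrite h3 in h1; move: h1 h2.
  rewrite !(dotDl, dotNl, dotDr, dotNr); lra.
elim: n n1 => // n IHn _; have [n0|n1] := posnP n.
  have e : \sum_(1 <= k < 1) alpha k ^+ 2 = 0 by rewrite big_geq.
  rewrite n0 !big_nat1 e.
  have := one 1%N isT.
  have h1 : dot (u 1%N) (xs - x 1%N) <= C * D.
    by have := dotC _ _ _ _ (uC 1%N isT) (ND 1%N isT); rewrite ler_norml => /andP[].
  have h2 : alpha 1%N * dot (u 1%N) (xs - x 1%N) <= alpha 1%N * (C * D).
    by rewrite ler_pM2l// a0.
  have h3 : 0 <= C ^+ 2 / sigma * alpha 1%N ^+ 2.
    by rewrite mulr_ge0 ?sqr_ge0// divr_ge0 ?sqr_ge0// ltW.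
  rewrite dotBl; lra.
have {IHn} IH := IHn n1.
rewrite !(big_nat_recr n.+1)//=.
have e : \sum_(1 <= k < n.+1) alpha k ^+ 2 = \sum_(1 <= k < n) alpha k ^+ 2 + alpha n ^+ 2.
  by rewrite (big_nat_recr n).
rewrite e in IH *.
have := one n.+1 isT; rewrite dotBl.
(* Abel summation: the two terms containing [u n.+1] differ by a change of step size, bounded here
   and telescoping since [alpha] decreases, and by the move from [x n] to [x n.+1], bounded in
   [h2]. *)
have h1 : (alpha n.+1 - alpha n) * dot (u n.+1) (xs - x n) <=
    (alpha n - alpha n.+1) * (C * D).
  rewrite -mulrNN opprB ler_wpM2l ?subr_ge0 ?amono//.
  have := dotC _ _ _ _ (uC n.+1 isT) (ND _ n1).
  by rewrite ler_norml => /andP[+ _]; rewrite lerNl.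
have h2 : alpha n.+1 * dot (u n.+1) (x n - x n.+1) <= C ^+ 2 / sigma * alpha n ^+ 2.
  have h : dot (u n.+1) (x n - x n.+1) <= C * (alpha n * (C / sigma)).
    rewrite (le_trans (ler_norm _))// dotC ?uC//.
    by rewrite (is_normB HN) step.
  have q0 : 0 <= C * (alpha n * (C / sigma)).
    by rewrite !mulr_ge0 ?invr_ge0 ?(ltW s0)// ltW// a0.
  rewrite (@le_trans _ _ (alpha n.+1 * (C * (alpha n * (C / sigma)))))//.
    by rewrite ler_pM2l// a0.
  have -> : C ^+ 2 / sigma * alpha n ^+ 2 = alpha n * (C * (alpha n * (C / sigma))) by ring.
  by rewrite ler_wpM2r// amono.
have h3 : alpha n.+1 * dot (u n.+1) (xs - x n.+1) =
    alpha n.+1 * dot (u n.+1) (xs - x n) + alpha n.+1 * dot (u n.+1) (x n - x n.+1).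
  by rewrite -mulrDr -dotDr addrA subrK.
lra.
Qed.

End mirror_step.

(** * Elementary estimates *)

Section numeric.
Context {R : realType}.
Implicit Types (y M t : R) (n : nat).

(* For [y < 2], [expR (- y / 2) >= 1 - y / 2] gives [expR y <= (1 - y / 2)^-2]. *)
Lemma expR_le_add_expR_sqr y : expR y <= y + expR (2 * y ^+ 2).
Proof.
have [y1|y1] := leP y 1; last first.
  have h : expR y <= expR (2 * y ^+ 2).
    by rewrite ler_expR expr2 mulrA ler_peMl//; lra.
  by rewrite (le_trans h)// lerDr; lra.
have h1 : 1 + 2 * y ^+ 2 <= expR (2 * y ^+ 2) by exact: expR_ge1Dx.
suff : expR y <= 1 + y + 2 * y ^+ 2 by lra.
have c0 : 0 < 1 - y / 2 by lra.
have h2 : (1 - y / 2) ^+ 2 <= expR (- y).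
  have -> : expR (- y) = expR (- (y / 2)) ^+ 2.
    by rewrite -expRM_natl; congr expR; field.
  by rewrite lerXn2r ?nnegrE ?expR_ge0 ?(ltW c0)// expR_ge1Dx.
have h3 : expR y * (1 - y / 2) ^+ 2 <= 1.
  have : expR y * (1 - y / 2) ^+ 2 <= expR y * expR (- y).
    by rewrite ler_pM2l ?expR_gt0.
  by rewrite -expRD subrr expR0.
rewrite -(@ler_pM2r _ ((1 - y / 2) ^+ 2)) ?exprn_gt0//.
apply: (le_trans h3); rewrite -subr_ge0.
(* The factor [1 - y] is the reason for the case split at 1. *)
have -> : (1 + y + 2 * y ^+ 2) * (1 - y / 2) ^+ 2 - 1 =
    y ^+ 2 * ((1 - y) * (5 / 2 - y)) / 2 by field.
by rewrite divr_ge0// mulr_ge0 ?sqr_ge0// mulr_ge0; lra.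
Qed.

(** The induction step is [ln (1 + h) <= h] at [h = - 1 / (n + 1)]. It requires [-1 < h], hence the
    separate case of a single term. *)
Lemma harmonic_sum_le n : (1 <= n)%N ->
  \sum_(1 <= k < n.+1) (k%:R^-1 : R) <= 1 + ln n%:R.
Proof.
elim: n => // n IH _; have [->|n1] := posnP n.
  by rewrite big_nat1 invr1 ln1 addr0.
rewrite (big_nat_recr n.+1)//= (le_trans (lerD (IH n1) (lexx _)))// -addrA lerD2l.
have n0 : 0 < n%:R :> R by rewrite ltr0n.
have m0 : 0 < n.+1%:R :> R by rewrite ltr0n.
have : ln (1 + (- n.+1%:R^-1)) <= - n.+1%:R^-1 :> R.
  by apply: le_ln1Dx; rewrite ltrN2 invf_lt1// ltr1n ltnS.
have -> : 1 + - n.+1%:R^-1 = n%:R / n.+1%:R :> R.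
  by rewrite -[in RHS](addrK 1 n%:R) natr1 mulrBl mulfV ?gt_eqF// mul1r.
rewrite ln_div ?posrE//.
by move: (ln n%:R) (ln n.+1%:R) (n.+1%:R^-1) => a b c; lra.
Qed.

Lemma sqrt_le_sum_inv_sqrt n : 
  Num.sqrt n%:R <= \sum_(1 <= k < n.+1) (1 / Num.sqrt k%:R : R).
Proof.
have [->|n0] := posnP n; first by rewrite sqrtr0 big_geq.
have s0 : 0 < Num.sqrt n%:R :> R by rewrite sqrtr_gt0 ltr0n.
have -> : Num.sqrt n%:R = \sum_(1 <= k < n.+1) (1 / Num.sqrt n%:R) :> R.
  rewrite sumr_const_nat subSS subn0 -[RHS]mulr_natl.
  by rewrite mul1r; apply: (canRL (mulfK (lt0r_neq0 s0))); rewrite -expr2 sqr_sqrtr.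
apply: ler_sum_nat => k /andP[k1 kn]; rewrite !mul1r lef_pV2 ?posrE//.
  by rewrite ler_wsqrtr// ler_nat.
by rewrite sqrtr_gt0 ltr0n.
Qed.

Lemma ln_le_sqrt t : 1 <= t -> ln t <= 2 * Num.sqrt t.
Proof.
move=> t1; have t0 : 0 < t by lra.
have s0 : 0 < Num.sqrt t by rewrite sqrtr_gt0.
rewrite -{1}(sqr_sqrtr (ltW t0)) lnXn// -[leLHS]mulr_natl ler_pM2l//.
have := @le_ln1Dx _ (Num.sqrt t - 1); rewrite addrCA subrr addr0 => h.
by rewrite (le_trans (h _))//; lra.
Qed.

(** Keeps the logarithm away from 0, so that additive constants can be absorbed into multiples of
    it. It is [ln h <= h - 1] at [h = 1 / (2 + M)]. *)
Lemma ln_ge_half (M : R) : 0 <= M -> 1 / 2 <= ln (2 + M).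
Proof.
move=> M0; suff h : - ln (2 + M) <= - (1 / 2) by lra.
rewrite -lnV ?posrE; last by lra.
have := @le_ln1Dx _ ((2 + M)^-1 - 1).
rewrite addrCA subrr addr0 => h.
have i0 : 0 < (2 + M)^-1 by rewrite invr_gt0; lra.
have i2 : (2 + M)^-1 <= 1 / 2 by rewrite mul1r lef_pV2 ?posrE; lra.
by rewrite (le_trans (h _))//; lra.
Qed.

(* With [l = ln (2 + M)] and [t = k ^ 4 (1 + M) l ^ 2 r], [r >= 1], one gets
   [1 + ln t <= 17 k l sqrt r], and [k = 16 * 17] makes [256 * 17 ^ 2 k ^ 2 = k ^ 4]. *)
Lemma log_threshold k M t : k = 16 * 17 -> 0 <= M ->
  k ^+ 4 * (1 + M) * ln (2 + M) ^+ 2 <= t ->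
  256 * (1 + M) * (1 + ln t) ^+ 2 <= t.
Proof.
move=> kE M0 Kt; have k1 : 1 <= k by lra.
have k0 : 0 < k by lra.
 have [l lE] : exists l, l = ln (2 + M) by exists (ln (2 + M)).
rewrite -lE in Kt *.
have l2 : 1 / 2 <= l by rewrite lE ln_ge_half.
have K0 : 0 < k ^+ 4 * (1 + M) * l ^+ 2.
  by apply: mulr_gt0; [apply: mulr_gt0|]; rewrite ?exprn_gt0//; lra.
have [r r1 tE] : exists2 r, 1 <= r & t = k ^+ 4 * (1 + M) * l ^+ 2 * r.
  exists (t / (k ^+ 4 * (1 + M) * l ^+ 2)); first by rewrite ler_pdivlMr// mul1r.
  by rewrite mulrC divfK ?gt_eqF.
have s1 : 1 <= Num.sqrt r by rewrite -sqrtr1 ler_wsqrtr.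
have rE : r = Num.sqrt r ^+ 2 by rewrite sqr_sqrtr//; lra.
have l0 : 0 < l by lra.
have r0 : 0 < r by lra.
have lnt : ln t <= 4 * k + l + 2 * l + 2 * Num.sqrt r.
  have M1 : 0 < 1 + M by lra.
  rewrite tE !lnM ?posrE ?mulr_gt0 ?exprn_gt0//.
  have a1 : ln k <= k.
    have := @le_ln1Dx _ (k - 1); rewrite addrCA subrr addr0 => h.
    by rewrite (le_trans (h _))//; lra.
  have a2 : ln (1 + M) <= l by rewrite lE ler_ln ?posrE; lra.
  have a3 : ln l <= l.
    have := @le_ln1Dx _ (l - 1); rewrite addrCA subrr addr0 => h.
    by rewrite (le_trans (h _))//; lra.
  have a4 := ln_le_sqrt r1.
  lra.
have u0 : 0 <= 1 + ln t.
  have : 1 <= t.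
    rewrite tE.
    have q1 : 1 / 4 <= l ^+ 2 by rewrite expr2; nra.
    have q2 : 1 / 4 <= (1 + M) * l ^+ 2 by rewrite mulrDl; nra.
    have q3 : 1 / 4 <= (1 + M) * l ^+ 2 * r.
      by rewrite (le_trans q2)// ler_peMr//; lra.
    rewrite -!mulrA; rewrite -mulrA in q3.
    have : k ^+ 4 * (1 / 4) <= k ^+ 4 * ((1 + M) * (l ^+ 2 * r)).
      by rewrite ler_pM2l ?exprn_gt0.
    have : k <= k ^+ 4 by rewrite exprS ler_peMr ?exprn_ege1// ltW.
    lra.
  by move=> /ln_ge0; lra.
have ls : l <= l * Num.sqrt r by rewrite ler_peMr// ltW.
(* With [X = l * sqrt r], the summands [1], [4 k], [3 l] and [2 sqrt r] are at most 2, 8, 3 and 4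
   times [k X], and [2 + 8 + 3 + 4 = 17]. *)
have ub : 1 + ln t <= 17 * k * (l * Num.sqrt r).
  have : Num.sqrt r <= 2 * (l * Num.sqrt r) by rewrite mulrA ler_peMl; lra.
  move: (l * Num.sqrt r) ls => X ls sX.
  have X1 : X <= k * X by rewrite ler_peMl; lra.
  have X2 : k <= k * (2 * X) by rewrite ler_peMr; lra.
  lra.
have : (1 + ln t) ^+ 2 <= (17 * k * (l * Num.sqrt r)) ^+ 2.
  by rewrite lerXn2r ?nnegrE//; lra.
rewrite !exprMn -rE => h.
rewrite [leRHS]tE.
have -> : k ^+ 4 * (1 + M) * l ^+ 2 * r =
   256 * (1 + M) * (17 ^+ 2 * k ^+ 2 * (l ^+ 2 * r)).
  by rewrite (exprD k 2 2) [X in X * _ * _ * _ * _ = _]expr2 {1 2}kE; ring.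
rewrite ler_wpM2l//; lra.
Qed.

End numeric.

(** * Borel measurability in finite dimension *)

Section borel_measurability.
Context {R : realType}.

Lemma closed_borel_measurable (T : ptopologicalType) (X : set T) :
  closed X -> measurable (X : set (borelType T)).
Proof.
move=> cX; rewrite -[X]setCK; apply: measurableC; apply: sub_sigma_algebra.
exact: closed_openC.
Qed.

(** The preimage of an open set is the trace on [X] of an open set; it is Borel in the whole space
    because [X] is closed. *)
Lemma within_continuous_measurable (T : ptopologicalType) (X : set T) (g : T -> R) :
  closed X -> {within X, continuous g} ->
  measurable_fun (X : set (borelType T)) (g : borelType T -> R).
Proof.
move=> cX /continuousP cg; apply: (measurability _ (RGenOpens.measurableE R)).
move=> _ [B oB <-].
have /open_subspaceP [V oV VD] : open (g @^-1` B : set (subspace X)).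
  by case: oB => a [b ->]; exact/cg/interval_open.
rewrite setIC -VD; apply: measurableI; last exact: closed_borel_measurable.
exact: sub_sigma_algebra.
Qed.

Lemma continuous_borel_measurable (T : ptopologicalType) (g : T -> R) :
  continuous g -> measurable_fun setT (g : borelType T -> R).
Proof.
move=> cg; apply: within_continuous_measurable; first exact: closedT.
exact: continuous_subspaceT.
Qed.

Context {d : nat}.

Lemma coord_borel_measurable (i : 'I_d) :
  measurable_fun setT (fun x : borelType 'rV[R]_d => x 0 i).
Proof.
apply: (@continuous_borel_measurable 'rV[R]_d (fun x => x 0 i)).
exact: coord_continuous.
Qed.

Lemma mx_norm_ltP (x y : 'rV[R]_d) (e : R) : 0 < e ->
  `|x - y| < e <-> forall i, `|x 0 i - y 0 i| < e.
Proof.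
move=> e0; split => [xy i|xy].
  rewrite (le_lt_trans _ xy)//; have := coord_le_norm (x - y) i.
  by rewrite !mxE.
rewrite /Num.norm/= mx_normrE; apply: bigmax_lt => // -[j i] _ /=.
by rewrite ord1 !mxE.
Qed.

(** Second countability made explicit: balls with rational centre and radius [1 / (m + 1)]. The
    radius is below [e / 2] so that such a ball, once it contains [x], stays in the [e]-ball around
    [x]. *)
Lemma open_rat_cover (U : set 'rV[R]_d) (x : 'rV[R]_d) : open U -> U x ->
  exists (q : 'rV[rat]_d) (m : nat),
    [set y | `|map_mx ratr q - y| < m.+1%:R^-1] `<=` U /\
    `|map_mx ratr q - x| < m.+1%:R^-1.
Proof.
move=> oU Ox; have /nbhs_ballP[e /= e0 eU] : nbhs x U by exact: open_nbhs_nbhs.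
have [m me] : exists m : nat, m.+1%:R^-1 < e / 2.
  have [m _ /(_ _ (leqnn m))] := near_infty_natSinv_lt (PosNum (divr_gt0 e0 (ltr0Sn R 1))).
  by exists m.
have m0 : 0 < m.+1%:R^-1 :> R by rewrite invr_gt0.
have /choice[q qP] : forall i, exists q : rat, `|ratr q - x 0 i| < m.+1%:R^-1.
  move=> i; have := @rat_in_itvoo R (x 0 i - m.+1%:R^-1) (x 0 i + m.+1%:R^-1).
  case=> [|q]; first by rewrite ltrD2l (lt_trans _ m0)// oppr_lt0.
  by rewrite in_itv/= => qP; exists q; rewrite ltr_distl.
exists (\row_i q i), m.
have qx : `|map_mx ratr (\row_i q i) - x| < m.+1%:R^-1.
  by apply/mx_norm_ltP => // i; rewrite !mxE.
split => // y /= qy; apply: eU; rewrite -ball_normE/=.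
have -> : x - y = - (map_mx ratr (\row_i q i) - x) + (map_mx ratr (\row_i q i) - y).
  by rewrite opprB addrA subrK.
rewrite (le_lt_trans (ler_normD _ _))// normrN.
by rewrite (lt_trans (ltrD qx qy))// [ltRHS]splitr ltrD.
Qed.

(** The Borel sets are generated by open sets, while coordinates only control boxes. Balls of the
    maximum norm are boxes, and countably many rational ones fill an open set. *)
Lemma measurable_fun_rV {disp} {T : measurableType disp} (D : set T)
    (z : T -> borelType 'rV[R]_d) :
  (forall i, measurable_fun D (fun w => z w 0 i)) -> measurable_fun D z.
Proof.
move=> mz mD; move: (mD); apply: (@measurability _ _ _ (borelType 'rV[R]_d) _ _ open erefl).
move=> _ [U oU <-].
(* Balls not contained in [U] contribute the empty set, so the union runs over a whole countable
   type. *)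
pose F (qm : 'rV[rat]_d * nat) := if `[< [set y : 'rV[R]_d |
    `|map_mx ratr qm.1 - y| < qm.2.+1%:R^-1] `<=` U >] then
  \bigcap_(i in [set: 'I_d])
    (D `&` [set w | `|ratr (qm.1 0 i) - z w 0 i| < qm.2.+1%:R^-1])
  else set0.
have -> : D `&` z @^-1` U = D `&` \bigcup_qm F qm.
  apply/seteqP; split => w.
    move=> [Dw /= Ow]; split => //; have [q [m [qU qz]]] := open_rat_cover oU Ow.
    exists (q, m) => //; rewrite /F; case: asboolP => // _ i _; split => //=.
    by have /mx_norm_ltP := qz; rewrite invr_gt0 => /(_ (ltr0Sn R m) i); rewrite !mxE.
  move=> [Dw [[q m] _]]; rewrite /F; case: asboolP => //= qU H; split => //=.
  apply: qU => /=; apply/mx_norm_ltP; first by rewrite invr_gt0.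
  by move=> i; have [_ /=] := H i I; rewrite mxE.
apply: measurableI => //; apply: countable_bigcupT_measurable.
  exact: countableP.
move=> [q m]; rewrite /F; case: asboolP => // _.
apply: fin_bigcap_measurable => // i _.
apply: (@emeasurable_fun_infty_o _ _ R D (fun w => `|ratr (q 0 i) - z w 0 i|%:E)
  mD _ (m.+1%:R^-1)%:E).
apply/measurable_EFinP; apply: measurableT_comp; first exact: normr_measurable.
by apply: measurable_funB => //; exact: mz.
Qed.

End borel_measurability.

(** * Conditional laws and martingale concentration *)

Section kernel_snd.
Context {R : realType} {d0 dT dS : measure_display} {T0 : measurableType d0}
  {T : measurableType dT} {S : measurableType dS}.

(** In a kernel composition the second kernel also receives the source of the first; this lets [K]
    ignore it. *)
Definition kernel_snd (K : R.-pker T ~> S) (x : T0 * T) : {measure set S -> \bar R} :=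
  K x.2.

Context (K : R.-pker T ~> S).

Let measurable_kernel_snd A : measurable A ->
  measurable_fun setT (kernel_snd K ^~ A).
Proof. by move=> mA; apply: measurableT_comp (measurable_kernel K _ mA) _. Qed.

HB.instance Definition _ :=
  isKernel.Build _ _ _ _ R (kernel_snd K) measurable_kernel_snd.

Let kernel_snd_prob x : kernel_snd K x setT = 1%E.
Proof. exact: prob_kernel. Qed.

HB.instance Definition _ :=
  Kernel_isProbability.Build _ _ _ _ R (kernel_snd K) kernel_snd_prob.

End kernel_snd.

Section disintegration.
Local Open Scope ereal_scope.
Context {R : realType} {dO dT dS : measure_display} {Omega : measurableType dO}
  {T : measurableType dT} {S : measurableType dS} (P : probability Omega R)
  (u : Omega -> T) (Y : Omega -> S) (K : R.-pker T ~> S).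
Hypothesis mu : measurable_fun setT u.
Hypothesis mY : measurable_fun setT Y.
Hypothesis KE : forall A B, measurable A -> measurable B ->
  P (u @^-1` A `&` Y @^-1` B) = \int[P]_(w in u @^-1` A) K (u w) B.


Let muY : measurable_fun setT (fun w => (u w, Y w)).
Proof. exact/measurable_fun_pairP. Qed.

Let uX : {mfun Omega >-> T} := HB.pack u (isMeasurableFun.Build _ _ _ _ _ mu).
Let uYX : {mfun Omega >-> (T * S)%type} :=
  HB.pack (fun w => (u w, Y w)) (isMeasurableFun.Build _ _ _ _ _ muY).

Let mswap : measurable_fun setT (fun z : (unit * T) * S => (z.1.2, z.2)).
Proof.
apply/measurable_fun_pairP; split => //=.
  rewrite [X in measurable_fun _ X](_ : _ = snd \o fst)//.
  exact: measurableT_comp.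
by rewrite [X in measurable_fun _ X](_ : _ = snd).
Qed.

(** [k2 (tt, t)] is the law of [(t, s)] for [s] distributed as [K t]. Composed with the law of [u],
    which is [k1], it is the candidate for the joint law of [(u, Y)]. *)
Let k2 : R.-sfker (unit * T)%type ~> (T * S)%type :=
  (kernel_snd K : _ -> {measure set S -> \bar R}) \; (kdirac mswap).

Let mcstu : measurable_fun setT
  (cst (distribution P uX : pprobability T R) : unit -> pprobability T R).
Proof. exact: measurable_cst. Qed.

Let k1 : R.-sfker unit ~> T := kprobability mcstu.

Let k2E t f : (forall z, 0 <= f z) -> measurable_fun setT f ->
  \int[k2 (tt, t)]_z f z = \int[K t]_s f (t, s).
Proof.
move=> f0 mf; rewrite integral_kcomp//; apply: eq_integral => s _.
by rewrite integral_dirac// diracT mul1e.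
Qed.

(** The joint law of [(u, Y)] and the composition of [k1] and [k2] agree on rectangles by [KE].
    Rectangles are stable under intersection and generate the product sigma-algebra, so the two
    measures are equal. *)
Lemma disintegration (f : T * S -> \bar R) : (forall z, 0 <= f z) ->
  measurable_fun setT f ->
  \int[P]_w f (u w, Y w) = \int[P]_w \int[K (u w)]_s f (u w, s).
Proof.
move=> f0 mf.
have -> : \int[P]_w f (u w, Y w) = \int[distribution P uYX]_z f z.
  by rewrite ge0_integral_distribution.
rewrite (eq_measure_integral (kcomp k1 k2 tt)); last first.
  move=> A mA _.
  pose G := [set A `*` B | A in @measurable _ T & B in @measurable _ S].
  apply: (measure_unique G (fun=> setT)) => //.
  - exact: measurable_prod_measurableType.
  - move=> _ _ [A1 mA1 [B1 mB1 <-]] [A2 mA2 [B2 mB2 <-]].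
    exists (A1 `&` A2); first exact: measurableI.
    by exists (B1 `&` B2); [exact: measurableI|rewrite setXI].
  - by move=> _; exists setT => //; exists setT => //; rewrite setXTT.
  - by rewrite bigcup_const//; exists 0%N.
  - move=> _ [B mB [C mC <-]].
    transitivity (P (u @^-1` B `&` Y @^-1` C)); first by [].
    rewrite KE// /kcomp.
    rewrite [RHS](_ : _ = \int[distribution P uX]_t (K t C * (\1_B t)%:E)); last first.
      apply: eq_integral => t _.
      have -> : k2 (tt, t) (B `*` C) = \int[k2 (tt, t)]_z (\1_(B `*` C) z)%:E.
        by rewrite integral_indic ?setIT//; exact: measurableX.
      rewrite k2E//; last first.
        by apply/measurable_EFinP; apply: measurable_indic; exact: measurableX.
      have [tB|tB] := boolP (t \in B).
        rewrite (eq_integral (fun s => (\1_C s)%:E)).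
          by rewrite integral_indic// setIT indicE tB mule1.
        by move=> s _; rewrite !indicE in_setX tB.
      rewrite indicE (negbTE tB) mule0 integral0_eq// => s _.
      by rewrite indicE in_setX (negbTE tB).
    rewrite (@ge0_integral_distribution _ _ _ _ _ P uX
      (fun t => K t C * (\1_B t)%:E)); last 2 first.
    - apply: emeasurable_funM; first exact: measurable_kernel.
      by apply/measurable_EFinP; exact: measurable_indic.
    - by move=> t; rewrite mule_ge0.
    rewrite integral_mkcond; apply: eq_integral => w _; rewrite patchE /= indicE.
    rewrite (_ : (w \in u @^-1` B) = (u w \in B)); last by apply/idP/idP; rewrite !inE.
    by case: ifPn => _; rewrite ?mule1 ?mule0.
  - move=> _; rewrite /distribution/= /pushforward.
    by rewrite (le_lt_trans (probability_le1 _ _))// ltry.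
rewrite integral_kcomp//.
under eq_integral do rewrite k2E//.
rewrite ge0_integral_distribution//.
- exact: (measurable_fun_integral_finite_kernel f K).
- by move=> t; apply: integral_ge0.
Qed.

Lemma disintegration_le (f : T * S -> \bar R) (g : Omega -> \bar R) :
  (forall z, 0 <= f z) -> measurable_fun setT f -> measurable_fun setT g ->
  (forall w, \int[K (u w)]_s f (u w, s) <= g w) ->
  \int[P]_w f (u w, Y w) <= \int[P]_w g w.
Proof.
move=> f0 mf mg fg; rewrite disintegration//.
have i0 w : 0 <= \int[K (u w)]_s f (u w, s) by exact: integral_ge0.
apply: ge0_le_integral => //.
apply: (measurableT_comp (f := fun t => \int[K t]_s f (t, s))) => //.
exact: (measurable_fun_integral_finite_kernel f K).
Qed.

End disintegration.

Section conditional_law.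
Context {R : realType} {dO dS : measure_display} {Omega : measurableType dO}
  {S : measurableType dS} (P : probability Omega R).

Lemma sub_sigma_measurable_fun (H : set (set Omega)) {d'} {T' : measurableType d'}
    (f : Omega -> T') : <<s H >> `<=` measurable ->
  measurable_fun setT (f : g_sigma_algebraType H -> T') -> measurable_fun setT f.
Proof. by move=> Hm mf _ A mA; apply: Hm; exact: mf. Qed.

(** Disintegration with [u] the identity into [Omega] equipped with the coarser sigma-algebra
    [<<s H >>]. There [Q] is a genuine probability kernel, and [f] may depend on the whole past. *)
Lemma conditional_law_integral_le (H : set (set Omega)) (Y : Omega -> S)
    (Q : Omega -> {measure set S -> \bar R})
    (f : g_sigma_algebraType H * S -> \bar R) (g : Omega -> \bar R) :
  <<s H >> `<=` measurable -> measurable_fun setT Y ->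
  (forall w, Q w setT = 1%E) -> conditional_law P H Y Q ->
  (forall z, 0 <= f z)%E -> measurable_fun setT f -> measurable_fun setT g ->
  (forall w, \int[Q w]_s f (w, s) <= g w)%E ->
  (\int[P]_w f (w, Y w) <= \int[P]_w g w)%E.
Proof.
move=> Hm mY Q1 QE f0 mf mg fg.
have mQ A : measurable A -> measurable_fun setT (fun w : g_sigma_algebraType H => Q w A).
  by move=> /QE[].
pose Q' : g_sigma_algebraType H -> {measure set S -> \bar R} := Q.
pose K1 := isKernel.Build _ _ _ _ R Q' mQ.
pose K : R.-ker (g_sigma_algebraType H) ~> S := HB.pack Q' K1.
pose K2 := Kernel_isProbability.Build _ _ _ _ R K Q1.
pose K' : R.-pker (g_sigma_algebraType H) ~> S := HB.pack Q' K1 K2.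
have mid : measurable_fun setT (id : Omega -> g_sigma_algebraType H).
  by move=> _ A mA; rewrite setTI; exact: Hm.
apply: (disintegration_le (u := id : Omega -> g_sigma_algebraType H) (K := K') mid mY) => //.
by move=> A B mA mB; have [_ ->] := QE _ mB.
Qed.

Lemma le_bound_integrable (Q : {measure set S -> \bar R}) (h : S -> R) (b : R) :
  Q setT = 1%E -> measurable_fun setT h -> (forall s, `|h s| <= b) ->
  Q.-integrable setT (EFin \o h).
Proof.
move=> Q1 mh hb; apply: measurable_bounded_integrable => //.
  by rewrite Q1 ltry.
exists b; split; first exact: num_real.
by move=> M bM s _ /=; rewrite (le_trans (hb s))// ltW.
Qed.

(** Integrating [expR y <= y + expR (2 * y ^+ 2)] kills the linear term. The exponent [2 * b ^+ 2]
    is weaker than Hoeffding's [b ^+ 2 / 2], at the cost of a constant only. The weight [W] stands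
    for the past, on which one conditions. *)
Lemma conditional_hoeffding (H : set (set Omega)) (Y : Omega -> S)
    (Q : Omega -> {measure set S -> \bar R})
    (W : Omega -> R) (y : Omega -> S -> R) (b : R) :
  <<s H >> `<=` measurable -> measurable_fun setT Y ->
  (forall w, Q w setT = 1%E) -> conditional_law P H Y Q ->
  (forall w, 0 <= W w) ->
  measurable_fun setT (W : g_sigma_algebraType H -> R) ->
  measurable_fun setT (fun z : g_sigma_algebraType H * S => y z.1 z.2) ->
  (forall w s, `|y w s| <= b) ->
  (forall w, \int[Q w]_s (y w s)%:E = 0)%E ->
  (\int[P]_w (W w * expR (y w (Y w)))%:E <=
   \int[P]_w (W w * expR (2 * b ^+ 2))%:E)%E.
Proof.
move=> Hm mY Q1 QE W0 mW my yb Qy.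
apply: (@conditional_law_integral_le H Y Q
  (fun z => (W z.1 * expR (y z.1 z.2))%:E)) => //.
- by move=> z; rewrite lee_fin mulr_ge0// expR_ge0.
- apply/measurable_EFinP; apply: measurable_funM.
    exact: measurableT_comp.
  by apply: measurableT_comp => //; exact: measurable_expR.
- apply/measurable_EFinP; apply: measurable_funM => //.
  exact: sub_sigma_measurable_fun mW.
move=> w /=.
have myw : measurable_fun setT (y w).
  exact: (@measurable_fun_pair2 _ _ _ (g_sigma_algebraType H) S _ (fun z => y z.1 z.2) w my).
have iy : (Q w).-integrable setT (EFin \o y w) by exact: le_bound_integrable (yb w).
have ic : (Q w).-integrable setT (EFin \o cst (expR (2 * b ^+ 2))).
  apply: (@le_bound_integrable _ _ (expR (2 * b ^+ 2))) => // s.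
  by rewrite /= ger0_norm// expR_ge0.
have mexp : measurable_fun setT (fun s => (expR (y w s))%:E).
  by apply/measurable_EFinP; apply: measurableT_comp => //; exact: measurable_expR.
under eq_integral do rewrite EFinM.
rewrite ge0_integralZl ?lee_fin//.
rewrite EFinM lee_wpmul2l ?lee_fin//.
have yle s : expR (y w s) <= y w s + expR (2 * b ^+ 2).
  rewrite (le_trans (expR_le_add_expR_sqr _))// lerD2l ler_expR ler_pM2l//.
  by rewrite -(real_normK (num_real (y w s))) lerXn2r ?nnegrE ?(le_trans (normr_ge0 _) (yb w s)).
apply: (@le_trans _ _ (\int[Q w]_s ((EFin \o y w) \+ (EFin \o cst (expR (2 * b ^+ 2)))) s)%E).
  apply: ge0_le_integral => //.
  - apply: emeasurable_funD; first exact/measurable_EFinP.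
    exact/measurable_EFinP.
  - by move=> s _; rewrite lee_fin.
rewrite integralD_EFin// Qy add0e.
rewrite -[X in (X <= _)%E]/(\int[Q w]_s cst (expR (2 * b ^+ 2))%:E s)%E.
by rewrite integral_cst// Q1 mule1.
Qed.

End conditional_law.

Section azuma.
Context {R : realType} {dO dS : measure_display} {Omega : measurableType dO}
  {S : measurableType dS} (P : probability Omega R)
  (H : nat -> set (set Omega)) (Y : nat -> Omega -> S)
  (Q : nat -> Omega -> {measure set S -> \bar R})
  (y : nat -> Omega -> S -> R) (b : nat -> R).
Hypothesis Hm : forall n, (1 <= n)%N -> <<s H n >> `<=` measurable.
Hypothesis mY : forall n, (1 <= n)%N -> measurable_fun setT (Y n).
Hypothesis Q1 : forall n w, Q n w setT = 1%E.
Hypothesis QE : forall n, (1 <= n)%N -> conditional_law P (H n) (Y n) (Q n).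
Hypothesis my : forall n, (1 <= n)%N ->
  measurable_fun setT (fun z : g_sigma_algebraType (H n) * S => y n z.1 z.2).
Hypothesis myY : forall k n, (1 <= k < n)%N ->
  measurable_fun setT (fun w : g_sigma_algebraType (H n) => y k w (Y k w)).
Hypothesis yb : forall n w s, (1 <= n)%N -> `|y n w s| <= b n.
Hypothesis Qy : forall n w, (1 <= n)%N -> (\int[Q n w]_s (y n w s)%:E = 0)%E.

Let sumY n w := \sum_(1 <= k < n.+1) y k w (Y k w).

Let sumYE n : sumY n = fun w => \sum_(k < n) y k.+1 w (Y k.+1 w).
Proof. by apply/funext => w; rewrite /sumY big_add1/= big_mkord. Qed.

(** Peel off the last increment: the exponential of the earlier ones is measurable for [H n.+1] by
    [myY] and serves as the weight [W]. *)
Lemma azuma_exp_moment n (t : R) :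
  (\int[P]_w (expR (t * sumY n w))%:E <=
   (expR (2 * t ^+ 2 * \sum_(1 <= k < n.+1) b k ^+ 2))%:E)%E.
Proof.
elim: n => [|n IH].
  rewrite big_geq// mulr0 expR0 (eq_integral (cst 1%E)); last first.
    by move=> w _; rewrite /sumY big_geq// mulr0 expR0.
  by rewrite integral_cst// mul1e probability_le1.
have msum : measurable_fun setT
    (fun w : g_sigma_algebraType (H n.+1) => expR (t * sumY n w)).
  apply: measurableT_comp; first exact: measurable_expR.
  apply: measurable_funM; first exact: measurable_cst.
  rewrite sumYE.
  by apply: measurable_sum => k; apply: myY; rewrite /= !ltnS ltn_ord.
have := @conditional_hoeffding _ _ _ _ _ P (H n.+1) (Y n.+1) (Q n.+1)
  (fun w => expR (t * sumY n w)) (fun w s => t * y n.+1 w s) (`|t| * b n.+1)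
  (@Hm n.+1 isT) (@mY n.+1 isT) (Q1 n.+1) (QE (n := n.+1) isT) _ msum.
move=> /(_ _ _ _ _)/wrap[].
- by move=> w; exact: expR_ge0.
- by apply: measurable_funM => //; exact: my.
- by move=> w s; rewrite normrM ler_wpM2l// yb.
- move=> w; under eq_integral do rewrite EFinM.
  have my1 : measurable_fun setT (y n.+1 w).
    exact: (@measurable_fun_pair2 _ _ _ (g_sigma_algebraType (H n.+1)) S _
      (fun z => y n.+1 z.1 z.2) w (my _)).
  rewrite integralZl ?Qy ?mule0//.
  by apply: (le_bound_integrable (b := b n.+1)) => // s; exact: yb.
rewrite /sumY => h.
under eq_integral do rewrite big_nat_recr//= mulrDr expRD.
apply: (le_trans h); under eq_integral do rewrite EFinM.
have mexp : measurable_fun setT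
    (fun w => (expR (t * \sum_(1 <= k < n.+1) y k w (Y k w)))%:E).
  by apply/measurable_EFinP; apply: sub_sigma_measurable_fun msum; exact: Hm.
rewrite ge0_integralZr ?lee_fin ?expR_ge0//.
rewrite (big_nat_recr n.+1)//= mulrDr expRD EFinM.
rewrite exprMn real_normK ?num_real// mulrA lee_wpmul2r//.
Qed.

Lemma azuma_tail n (t l : R) : 0 < t ->
  (P [set w | (l <= sumY n w)%R] <=
   (expR (2 * t ^+ 2 * \sum_(1 <= k < n.+1) b k ^+ 2 - t * l))%:E)%E.
Proof.
move=> t0.
have msum : measurable_fun setT (sumY n).
  rewrite sumYE.
  apply: measurable_sum => k.
  apply: (sub_sigma_measurable_fun (H := H n.+1)); first exact: Hm.
  by apply: myY; rewrite /= !ltnS ltn_ord.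
pose X : {RV P >-> R} := HB.pack (sumY n) (isMeasurableFun.Build _ _ _ _ _ msum).
apply: (le_trans (chernoff X l t0)).
rewrite expRD EFinM lee_wpmul2r ?lee_fin ?expR_ge0//.
apply: le_trans (azuma_exp_moment n t).
rewrite /mmt_gen_fun unlock.
rewrite [leLHS](eq_integral (fun w => (expR (t * sumY n w))%:E))// => w _ /=.
by rewrite mulrC.
Qed.
End azuma.

(** * The noise of the stochastic gradients *)

Section vintegral.
Context {R : realType} {d : nat} {dS : measure_display} {S : measurableType dS}
  (Q : {measure set S -> \bar R}) (h : S -> 'rV[R]_d) (b : 'I_d -> R).
Hypothesis Q1 : Q setT = 1%E.
Hypothesis mh : forall i, measurable_fun setT (fun s => h s 0 i).
Hypothesis hb : forall s i, `|h s 0 i| <= b i.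

Lemma measurable_dot (v : 'rV[R]_d) : measurable_fun setT (fun s => dot (h s) v).
Proof.
by apply: measurable_sum => i; apply: measurable_funM.
Qed.

(** [vintegral] is made of real-valued integrals, which agree with the extended ones only when
    finite; the bounds [b] guarantee this. *)
Lemma integral_dot_vintegral (v : 'rV[R]_d) :
  (\int[Q]_s (dot (h s) v)%:E = (dot (vintegral Q h) v)%:E)%E.
Proof.
have ih i : Q.-integrable setT (fun s => (h s 0 i)%:E).
  exact: (le_bound_integrable (b := b i)).
under eq_integral do rewrite /dot -sumEFin.
rewrite integral_sum//; last first.
  move=> i; under eq_fun do rewrite EFinM.
  exact: integrableZr.
rewrite /dot -sumEFin; apply: eq_bigr => i _.
under eq_integral do rewrite EFinM.
rewrite integralZr// EFinM mxE /Rintegral fineK//.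
exact: integrable_fin_num.
Qed.

Lemma abs_dot_vintegral_le (v : 'rV[R]_d) (c : R) :
  (forall s, `|dot (h s) v| <= c) -> `|dot (vintegral Q h) v| <= c.
Proof.
move=> hc; rewrite -lee_fin -abse_EFin -integral_dot_vintegral.
have md : measurable_fun setT (fun s => (dot (h s) v)%:E).
  by apply/measurable_EFinP; exact: measurable_dot.
apply: (le_trans (le_abse_integral _ _ md)) => //.
apply: (@le_trans _ _ (\int[Q]_s cst c%:E s)%E).
  apply: ge0_le_integral => //.
  - exact: measurableT_comp.
  - by move=> s _; rewrite lee_fin.
by rewrite integral_cst// Q1 mule1.
Qed.

End vintegral.

Section history.
Context {R : realType} {dO dE dS : measure_display} {Omega : measurableType dO}
  {E : measurableType dE} {S : measurableType dS}
  (x : nat -> Omega -> E) (s : nat -> Omega -> S).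
Hypothesis mx : forall k, measurable_fun setT (x k).
Hypothesis ms : forall k, measurable_fun setT (s k).

Lemma history_measurable n : <<s history_gen x s n >> `<=` measurable.
Proof.
apply: smallest_sub; first exact: sigma_algebra_measurable.
move=> _ [k _ [[A mA <-]|[A mA <-]]].
- exact: mx.
- exact: ms.
Qed.

Lemma history_measurable_fun1 k n : (1 <= k <= n)%N ->
  measurable_fun setT (x k : g_sigma_algebraType (history_gen x s n) -> E).
Proof.
move=> kn _ A mA; apply: sub_sigma_algebra; exists k => //; left.
by exists A.
Qed.

Lemma history_measurable_fun2 k n : (1 <= k <= n)%N ->
  measurable_fun setT (s k : g_sigma_algebraType (history_gen x s n) -> S).
Proof.
move=> kn _ A mA; apply: sub_sigma_algebra; exists k => //; right.
by exists A.
Qed.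

End history.

Section composition.
Context {R : realType} {d : nat} {S : ptopologicalType} {dT : measure_display}
  {T : measurableType dT} (X : set 'rV[R]_d).

Lemma jointly_measurable_coord (G : 'rV[R]_d -> S -> 'rV[R]_d)
    (a : T -> borelType 'rV[R]_d) (b : T -> borelType S) (i : 'I_d) :
  closed X -> jointly_measurable_on X G ->
  measurable_fun setT a -> measurable_fun setT b -> (forall t, X (a t)) ->
  measurable_fun setT (fun t => G (a t) (b t) 0 i).
Proof.
move=> cX mG ma mb aX.
have mX : measurable (X : set (borelType 'rV[R]_d)).
  exact: (@closed_borel_measurable 'rV[R]_d).
apply: (measurableT_comp (f := fun y : borelType 'rV[R]_d => y 0 i)
  (g := fun t => G (a t) (b t) : borelType 'rV[R]_d)).
  exact: coord_borel_measurable.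
apply: (measurable_comp (F := X `*` setT : set (borelType 'rV[R]_d * borelType S))
  (f := fun u : borelType 'rV[R]_d * borelType S => G u.1 u.2 : borelType 'rV[R]_d)
  (g := fun t => (a t, b t)) _ _ mG).
- exact: measurableX.
- by move=> _ [t _ <-]; split => //=; exact: aX.
- exact/measurable_fun_pairP.
Qed.

Lemma within_continuous_measurable_comp (g : 'rV[R]_d -> R)
    (a : T -> borelType 'rV[R]_d) :
  closed X -> {within X, continuous g} -> measurable_fun setT a ->
  (forall t, X (a t)) -> measurable_fun setT (fun t => g (a t)).
Proof.
move=> cX cg ma aX.
have mX : measurable (X : set (borelType 'rV[R]_d)).
  exact: (@closed_borel_measurable 'rV[R]_d).
have mg : measurable_fun (X : set (borelType 'rV[R]_d)) (g : borelType 'rV[R]_d -> R).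
  exact: (@within_continuous_measurable R 'rV[R]_d X g cX cg).
apply: (measurable_comp (F := X : set (borelType 'rV[R]_d))
  (f := g : borelType 'rV[R]_d -> R) (g := a) mX _ mg) => //.
by move=> _ [t _ <-]; exact: aX.
Qed.

End composition.

Section noise.
Context {R : realType} {d : nat} {S : ptopologicalType} {dO : measure_display}
  {Omega : measurableType dO} (P : probability Omega R)
  (N : 'rV[R]_d -> R) (X : set 'rV[R]_d)
  (Pi : 'rV[R]_d -> R.-pker borelType S ~> borelType S)
  (gr : 'rV[R]_d -> 'rV[R]_d) (G Gt : 'rV[R]_d -> S -> 'rV[R]_d)
  (C : R) (alpha : nat -> R)
  (x : nat -> {RV P >-> borelType 'rV[R]_d})
  (s : nat -> {RV P >-> borelType S}) (xs : 'rV[R]_d).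
Let D := diameter N X.
Hypothesis HN : is_norm N.
Hypothesis cX : compact X.
Hypothesis xsX : X xs.
Hypothesis cgr : {within X, continuous gr}.
Hypothesis mG : jointly_measurable_on X G.
Hypothesis mGt : jointly_measurable_on X Gt.
Hypothesis poisson : forall y t, X y ->
  G y t - gr y = Gt y t - vintegral (Pi y t) (Gt y).
Hypothesis GtC : forall y t, X y -> dual_norm N (Gt y t) <= C.
Hypothesis xX : forall k w, (1 <= k)%N -> X (x k w).
Hypothesis law : forall n, (1 <= n)%N ->
  conditional_law P (history_gen x s n) (s n.+1) (fun w => Pi (x n w) (s n w)).
Hypothesis a0 : forall k, (1 <= k)%N -> 0 <= alpha k.

(** On [X] this is [Gt (x_k, s') - (Pi Gt) (x_k, s_k)] by the Poisson equation. Written without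
    [Pi Gt], it is measurable directly from [G], [Gt] and [gr], and has the form of [xi] in
    [mirror_descent_sum_le]. *)
Definition noise k w s' :=
  Gt (x k w) s' - Gt (x k w) (s k w) + G (x k w) (s k w) - gr (x k w).

Let y k w s' := alpha k * dot (noise k w s') (xs - x k w).

Let closedX : closed X.
Proof. by apply: compact_closed => //; exact: norm_hausdorff. Qed.

Let coord_gr i : {within X, continuous (fun z => gr z 0 i)}.
Proof.
apply/continuousP => A oA.
move/continuousP : cgr => /(_ ((fun v : 'rV[R]_d => v 0 i) @^-1` A)); apply.
by move: A oA; apply/continuousP; exact: coord_continuous.
Qed.

Let mGt_section z i : X z -> measurable_fun setT (fun t : borelType S => Gt z t 0 i).
Proof.
move=> Xz; apply: (@jointly_measurable_coord _ _ _ _ (borelType S) X Gt (cst z) id) => //.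
Qed.

Let noiseE k w s' : (1 <= k)%N ->
  noise k w s' = Gt (x k w) s' - vintegral (Pi (x k w) (s k w)) (Gt (x k w)).
Proof.
move=> k1; rewrite /noise -!addrA; congr (_ + _).
by rewrite poisson ?addrA ?addNr ?add0r//; exact: xX.
Qed.

Let Pi1 z t : Pi z t setT = 1%E. Proof. exact: prob_kernel. Qed.

Let coordGt z t i : X z -> `|Gt z t 0 i| <= C * N (delta_mx 0 i).
Proof.
move=> Xz; rewrite (le_trans (coord_le_dual_norm HN _ _))// ler_wpM2r ?GtC//.
by case: HN.
Qed.

Let dotGt z t : X z -> `|dot (Gt z t) (xs - z)| <= C * D.
Proof.
move=> Xz; rewrite (le_trans (abs_dot_le_dual_norm HN _ _))//.
rewrite ler_pM ?GtC ?(dual_norm_ge0 HN) ?(is_norm_le_diameter HN)//.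
by case: HN.
Qed.

Let dot_noise_mean0 k w : (1 <= k)%N ->
  (\int[Pi (x k w) (s k w)]_t (y k w t)%:E = 0)%E.
Proof.
move=> k1; have Xx := xX w k1.
set v := vintegral (Pi (x k w) (s k w)) (Gt (x k w)).
have mg i := mGt_section i Xx.
have hv := integral_dot_vintegral (Pi1 (x k w) (s k w)) mg
  (fun t i => coordGt t i Xx) (xs - x k w).
pose h1 (t : borelType S) := dot (Gt (x k w) t) (xs - x k w).
pose h2 (t : borelType S) := - dot v (xs - x k w).
have ih1 : (Pi (x k w) (s k w)).-integrable setT (EFin \o h1).
  apply: (le_bound_integrable (b := C * D)) => //; first exact: measurable_dot.
  by move=> t; exact: dotGt.
have ih2 : (Pi (x k w) (s k w)).-integrable setT (EFin \o h2).
  by apply: (le_bound_integrable (b := `|- dot v (xs - x k w)|)) => //; exact: measurable_cst.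
rewrite (eq_integral (fun t =>
    (alpha k)%:E * ((EFin \o h1) \+ (EFin \o h2)) t)%E); last first.
  by move=> t _; rewrite /y noiseE// dotBl EFinM.
rewrite integralZl//; last exact: integrableD.
rewrite integralD_EFin// hv.
rewrite -[X in (_ * (_ + X))%E]/(\int[_]_t cst (- dot v (xs - x k w))%:E t)%E.
by rewrite integral_cst// Pi1 mule1 -EFinD subrr mule0.
Qed.

Let dot_noise_bound k w t : (1 <= k)%N -> `|y k w t| <= alpha k * (2 * C * D).
Proof.
move=> k1; have Xx := xX w k1.
rewrite /y normrM ger0_norm ?a0// ler_wpM2l ?a0// noiseE// dotBl.
rewrite (le_trans (ler_normB _ _))//.
rewrite -mulrA mulr_natl mulr2n lerD ?dotGt//.
apply: (abs_dot_vintegral_le (b := fun i => C * N (delta_mx 0 i))) => //.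
- by move=> i; exact: mGt_section.
- by move=> t' i; exact: coordGt.
- by move=> t'; exact: dotGt.
Qed.

(** The source [T] is left free because three are needed: [Omega], [Omega] with the history
    sigma-algebra, and the product of the latter with the state space. *)
Let measurable_dot_noise {dT} {T : measurableType dT} k (a : T -> borelType 'rV[R]_d)
    (b c : T -> borelType S) : (1 <= k)%N ->
  measurable_fun setT a -> measurable_fun setT b -> measurable_fun setT c ->
  (forall t, X (a t)) ->
  measurable_fun setT (fun t => alpha k *
    dot (Gt (a t) (c t) - Gt (a t) (b t) + G (a t) (b t) - gr (a t)) (xs - a t)).
Proof.
move=> k1 ma mb mc aX.
apply: measurable_funM => //; apply: measurable_sum => i.
under eq_fun do rewrite !mxE.
apply: measurable_funM.
  apply: measurable_funB.
    apply: measurable_funD; last exact: (jointly_measurable_coord (X := X)).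
    by apply: measurable_funB; exact: (jointly_measurable_coord (X := X)).
  exact: (within_continuous_measurable_comp (X := X) (g := fun z => gr z 0 i)).
apply: measurable_funB => //.
apply: (measurableT_comp (f := fun y : borelType 'rV[R]_d => y 0 i) (g := a)) => //.
exact: coord_borel_measurable.
Qed.

Lemma measurable_noise_sum n :
  measurable_fun setT (fun w => \sum_(1 <= k < n.+1)
      alpha k * dot (noise k w (s k.+1 w)) (xs - x k w)).
Proof.
under eq_fun do rewrite big_add1/= big_mkord.
apply: measurable_sum => k.
apply: (@measurable_dot_noise _ Omega k.+1 (x k.+1) (s k.+1) (s k.+2)) => //.
by move=> w; exact: xX.
Qed.

Lemma noise_tail n (t l : R) : 0 < t ->
  (P [set w | (l <= \sum_(1 <= k < n.+1)
      alpha k * dot (noise k w (s k.+1 w)) (xs - x k w))%R] <=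
   (expR (2 * t ^+ 2 * \sum_(1 <= k < n.+1) (alpha k * (2 * C * D)) ^+ 2
          - t * l))%:E)%E.
Proof.
(* The [n]-th observation is [s n.+1], the first state outside the history up to [n]. *)
apply: (@azuma_tail _ _ _ _ (borelType S) P (history_gen x s) (fun n => s n.+1)
  (fun n w => Pi (x n w) (s n w)) y (fun k => alpha k * (2 * C * D))).
- by move=> m _; apply: history_measurable => k; exact: measurable_funPT.
- by move=> m _; exact: measurable_funPT.
- by move=> m w; exact: Pi1.
- exact: law.
- move=> m m1; apply: (@measurable_dot_noise _
    (g_sigma_algebraType (history_gen x s m) * borelType S)%type m
    (fun z => x m z.1) (fun z => s m z.1) snd m1) => //.
  + apply: measurableT_comp => //.
    by apply: history_measurable_fun1; rewrite m1 leqnn.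
  + apply: measurableT_comp => //.
    by apply: history_measurable_fun2; rewrite m1 leqnn.
  + by move=> z; exact: xX.
- move=> k m /andP[k1 km].
  apply: (@measurable_dot_noise _ (g_sigma_algebraType (history_gen x s m)) k
    (x k) (s k) (s k.+1) k1) => //.
  + by apply: history_measurable_fun1; rewrite k1 ltnW.
  + by apply: history_measurable_fun2; rewrite k1 ltnW.
  (* The strict inequality [k < m] is what places [s k.+1] in the history up to [m]. *)
  + by apply: history_measurable_fun2.
  + by move=> z; exact: xX.
- by move=> m w t' m1; exact: dot_noise_bound.
- by move=> m w m1; exact: dot_noise_mean0.
Qed.

End noise.

(** * The threshold *)

Lemma least_threshold_le (Q : nat -> Prop) m : (0 < m)%N ->
  (forall n, (m <= n)%N -> Q n) ->
  exists2 N, is_least_threshold Q N & (N <= m)%N.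
Proof.
move=> m0 Qm.
pose B k := (0 < k)%N && `[< forall n, (k <= n)%N -> Q n >].
have Bm : exists k, B k by exists m; rewrite /B m0; apply/asboolP.
case: (ex_minnP Bm) => N /andP[N0 /asboolP QN] Nmin.
exists N; last by apply: Nmin; rewrite /B m0; apply/asboolP.
split => // k k0 Qk; apply: Nmin; rewrite /B k0.
exact/asboolP.
Qed.

Section numeric.
Context {R : realType}.

Lemma ler_of_sqr (a b : R) : 0 <= b -> a ^+ 2 <= b ^+ 2 -> a <= b.
Proof.
move=> b0; have [a0|a0 _] := leP 0 a; first by rewrite ler_sqr ?nnegrE.
exact: le_trans (ltW a0) b0.
Qed.

(** Each summand is compared with [eps * r / 8] after squaring, where it is a multiple of a member
    of the maximum. The factor [T ^+ 2] covers both [H], from the variance, and [H ^+ 2], from the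
    squared regret terms. *)
Lemma threshold_bounds (D1 D C sigma L l eps H T n r : R) :
  let M := (eps ^+ 2)^-1 * Num.max (D1 ^+ 2 + C ^+ 2 * D ^+ 2)
      (Num.max ((C ^+ 4 + C ^+ 2 * (1 + 2 * L * D) ^+ 2) / sigma ^+ 2)
         (C ^+ 2 * D ^+ 2 * l)) in
  0 < sigma -> 0 <= C -> 0 <= D -> 0 <= L -> 0 < eps -> 0 <= H <= T -> 1 <= T ->
  0 <= r -> r ^+ 2 = n -> 256 * (1 + M) * T ^+ 2 <= n ->
  D1 + 2 * C * D + (3 / 2 * (C ^+ 2 / sigma) + L * C * D / sigma) * H <= eps * r / 2
  /\ 128 * (C ^+ 2 * D ^+ 2 * l) * H <= eps ^+ 2 * n.
Proof.
move=> M s0 C0 D0 L0 e0 /andP[H0 HT] T1 r0 rn Mn.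
have e20 : 0 < eps ^+ 2 by rewrite exprn_gt0.
have [m mM] : exists m, m = eps ^+ 2 * M by exists (eps ^+ 2 * M).
have mE : m = Num.max (D1 ^+ 2 + C ^+ 2 * D ^+ 2)
    (Num.max ((C ^+ 4 + C ^+ 2 * (1 + 2 * L * D) ^+ 2) / sigma ^+ 2)
       (C ^+ 2 * D ^+ 2 * l)).
  by rewrite mM /M mulrA mulfV ?gt_eqF// mul1r.
have T2 : T <= T ^+ 2 by rewrite expr2 ler_peMr//; lra.
have T20 : 1 <= T ^+ 2 by lra.
have mn : 256 * m * T ^+ 2 <= eps ^+ 2 * n.
  have : eps ^+ 2 * (256 * (1 + M) * T ^+ 2) <= eps ^+ 2 * n by rewrite ler_pM2l.
  have : 0 <= eps ^+ 2 * T ^+ 2 by rewrite mulr_ge0 ?sqr_ge0.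
  move: M mM Mn {mE} => M -> Mn; lra.
have [h1 h2 h3] : [/\ D1 ^+ 2 + C ^+ 2 * D ^+ 2 <= m,
    (C ^+ 4 + C ^+ 2 * (1 + 2 * L * D) ^+ 2) / sigma ^+ 2 <= m
    & C ^+ 2 * D ^+ 2 * l <= m].
  by rewrite mE; split; rewrite !le_max lexx ?orbT.
have CD0 : 0 <= C ^+ 2 * D ^+ 2 by rewrite mulr_ge0 ?sqr_ge0.
have D12 : 0 <= D1 ^+ 2 by rewrite sqr_ge0.
have m0 : 0 <= m by lra.
have mT : m <= m * T ^+ 2 by rewrite ler_peMr.
have mH : m * H <= m * T ^+ 2 by rewrite ler_wpM2l//; lra.
have mH2 : m * H ^+ 2 <= m * T ^+ 2 by rewrite ler_wpM2l// lerXn2r ?nnegrE//; lra.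
have er0 : 0 <= eps * r / 8 by rewrite divr_ge0// mulr_ge0// ltW.
have er2 : (eps * r / 8) ^+ 2 = eps ^+ 2 * n / 64 by rewrite -rn; field.
have b1 : D1 <= eps * r / 8 by apply: ler_of_sqr => //; rewrite er2; lra.
have b2 : 2 * C * D <= eps * r / 8.
  by apply: ler_of_sqr => //; rewrite er2 !exprMn; lra.
have is0 : 0 <= (sigma ^+ 2)^-1 by rewrite invr_ge0 sqr_ge0.
have [k1 k2] : (C ^+ 2 / sigma) ^+ 2 <= m /\ 4 * (L * C * D / sigma) ^+ 2 <= m.
  have -> : (C ^+ 2 / sigma) ^+ 2 = C ^+ 4 / sigma ^+ 2 by field; rewrite gt_eqF.
  have -> : 4 * (L * C * D / sigma) ^+ 2 = C ^+ 2 * (2 * L * D) ^+ 2 / sigma ^+ 2.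
    by field; rewrite gt_eqF.
  have LD0 : 0 <= 2 * L * D by rewrite !mulr_ge0.
  have j1 : C ^+ 2 * (2 * L * D) ^+ 2 <= C ^+ 2 * (1 + 2 * L * D) ^+ 2.
    by rewrite ler_wpM2l ?sqr_ge0// lerXn2r ?nnegrE//; lra.
  have j0 : 0 <= C ^+ 2 * (2 * L * D) ^+ 2 by rewrite mulr_ge0 ?sqr_ge0.
  have j2 : 0 <= C ^+ 4 by rewrite exprn_ge0.
  by split; apply: le_trans h2; rewrite ler_wpM2r//; lra.
have b3 : 3 / 2 * (C ^+ 2 / sigma) * H <= eps * r / 8.
  apply: ler_of_sqr => //; rewrite er2.
  have -> : (3 / 2 * (C ^+ 2 / sigma) * H) ^+ 2 = 9 / 4 * ((C ^+ 2 / sigma) ^+ 2 * H ^+ 2).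
    by field; rewrite gt_eqF.
  have : (C ^+ 2 / sigma) ^+ 2 * H ^+ 2 <= m * H ^+ 2 by rewrite ler_wpM2r ?sqr_ge0.
  lra.
have b4 : L * C * D / sigma * H <= eps * r / 8.
  apply: ler_of_sqr => //; rewrite er2 exprMn.
  have : 4 * (L * C * D / sigma) ^+ 2 * H ^+ 2 <= m * H ^+ 2 by rewrite ler_wpM2r ?sqr_ge0.
  lra.
split; first lra.
have : C ^+ 2 * D ^+ 2 * l * H <= m * H by rewrite ler_wpM2r.
lra.
Qed.

(** The choice [t = 2 * l / lam] makes the linear term [- 2 * l], and the hypothesis on [V] keeps
    the quadratic term below [l]. *)
Lemma sub_gaussian_exponent (l lam V : R) : 0 < l -> 0 < lam -> 8 * l * V <= lam ^+ 2 ->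
  2 * (2 * l / lam) ^+ 2 * V - 2 * l / lam * lam <= - l.
Proof.
move=> l0 lam0 h; rewrite divfK ?gt_eqF//.
suff : 2 * (2 * l / lam) ^+ 2 * V <= l by lra.
rewrite (_ : _ * V = (8 * l * V) * l / lam ^+ 2); last by field; rewrite gt_eqF.
by rewrite ler_pdivrMr ?exprn_gt0// [leRHS]mulrC ler_pM2r.
Qed.

End numeric.

(** * Weighted averages of the iterates, and the supremum [D1] *)

Section averages.
Context {R : realType} {d : nat}.
Implicit Types (X : set 'rV[R]_d) (f : 'rV[R]_d -> R).

Lemma convex_weighted_average X (alpha : nat -> R) (y : nat -> 'rV[R]_d) n :
  convex_set X -> (forall k, (1 <= k)%N -> 0 < alpha k) ->
  (forall k, (1 <= k)%N -> X (y k)) -> (1 <= n)%N ->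
  X ((\sum_(1 <= k < n.+1) alpha k)^-1 *: \sum_(1 <= k < n.+1) alpha k *: y k).
Proof.
move=> cX a0 Xy; elim: n => // n IH _; have [->|n1] := posnP n.
  by rewrite !big_nat1 scalerA mulVf ?scale1r ?gt_eqF ?a0//; exact: Xy.
have {}IH := IH n1.
have A0 : 0 < \sum_(1 <= k < n.+1) alpha k.
  rewrite big_add1/= big_mkord; case: n n1 {IH} => // n _.
  by rewrite big_ord_recl ltr_wpDr ?a0// sumr_ge0// => i _; rewrite ltW// a0.
rewrite !(big_nat_recr n.+1)//=.
set A := \sum_(_ <= _ < _) _ in A0 IH *; set Z := \sum_(_ <= _ < _) _ in IH *.
have a1 := a0 n.+1 isT; have Aa : 0 < A + alpha n.+1 by rewrite addr_gt0.
have -> : (A + alpha n.+1)^-1 *: (Z + alpha n.+1 *: y n.+1) =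
    (alpha n.+1 / (A + alpha n.+1)) *: y n.+1 +
    (1 - alpha n.+1 / (A + alpha n.+1)) *: (A^-1 *: Z).
  rewrite scalerDr addrC !scalerA; congr (_ *: _ + _ *: _); first by rewrite mulrC.
  by field; rewrite !gt_eqF.
apply: convex_set_segment => //; first exact: Xy.
rewrite divr_ge0 ?(ltW a1) ?(ltW Aa)//= ler_pdivrMr// mul1r lerDr ltW//.
Qed.

(** Jensen through the tangent at the average [z]: the weighted sum of [y k - z] vanishes, so the
    gradient inequalities at [z] cost nothing in total. They are added to those at each [y k]
    towards [xs]. *)
Lemma convex_average_gap_le X f (alpha : nat -> R) (y : nat -> 'rV[R]_d)
    (xs : 'rV[R]_d) n :
  let A := \sum_(1 <= k < n.+1) alpha k in
  convex_set X -> convex_function X f ->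
  (forall z, X z -> differentiable f z) ->
  (forall k, (1 <= k)%N -> 0 < alpha k) ->
  (forall k, (1 <= k)%N -> X (y k)) -> X xs -> (1 <= n)%N -> 0 < A ->
  A * (f (A^-1 *: \sum_(1 <= k < n.+1) alpha k *: y k) - f xs) <=
  \sum_(1 <= k < n.+1) alpha k * dot (grad f (y k)) (y k - xs).
Proof.
move=> A cX cf df a0 Xy Xxs n1 A0.
have Xz := convex_weighted_average cX a0 Xy n1.
set z := _ *: _ in Xz *.
have zE : \sum_(1 <= k < n.+1) alpha k *: (y k - z) = 0.
  under eq_bigr do rewrite scalerBr.
  rewrite sumrB -scaler_suml -/A /z scalerA mulfV ?gt_eqF// scale1r.
  exact: subrr.
have dotE : \sum_(1 <= k < n.+1) alpha k * dot (grad f z) (y k - z) = 0.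
  transitivity (dot (grad f z) (\sum_(1 <= k < n.+1) alpha k *: (y k - z))).
    rewrite (big_morph (dot _) (fun u v => dotDr u v (grad f z)) (dot0r _)).
    by apply: eq_bigr => k _; rewrite dotZr.
  by rewrite zE dot0r.
have -> : A * (f z - f xs) = \sum_(1 <= k < n.+1) alpha k * (f z - f xs).
  by rewrite /A mulr_suml.
rewrite -[leLHS]addr0 -[X in _ + X <= _]dotE -big_split/=.
apply: ler_sum_nat => k /andP[k1 _]; rewrite -mulrDr ler_pM2l ?a0//.
have h1 := convex_gradient_le cf Xz (Xy _ k1) (df _ Xz).
have h2 := convex_gradient_le cf (Xy _ k1) Xxs (df _ (Xy _ k1)).
have : dot (grad f (y k)) (y k - xs) = - dot (grad f (y k)) (xs - y k).
  by rewrite -dotNr opprB.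
lra.
Qed.

(** The supremum is meaningful because the divergence is continuous in its second argument, the
    gradient being differentiable, and [X] is compact. *)
Lemma bregman_le_sup (g : 'rV[R]_d -> R) X x y : compact X ->
  twice_continuously_differentiable g -> X y ->
  bregman g x y <= sup [set bregman g x z | z in X].
Proof.
move=> cX [dg dgg _] Xy.
have cdot : continuous (fun z => dot (grad g z) (x - z)).
  apply: (continuous_big (op := +%R)); first exact: add_continuous.
  move=> i _ z.
  have cgi : continuous ((fun v : 'rV[R]_d => v 0 i) \o grad g).
    move=> z'; apply: continuous_comp; last exact: coord_continuous.
    exact: differentiable_continuous (dgg z').
  apply: (@cvgM _ _ _ (nbhs_filter z)); first exact: cgi.
  under eq_fun do rewrite !mxE.
  rewrite [X in nbhs X]mxE [X in nbhs (_ + X)]mxE.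
  apply: (@cvgB _ _ _ _ (nbhs_filter z)); first exact: cvg_cst.
  exact: coord_continuous.
have cb : continuous (bregman g x).
  move=> z; rewrite /bregman /continuous_at.
  apply: (@cvgB _ _ _ _ (nbhs_filter z)); last exact: cdot.
  apply: (@cvgB _ _ _ _ (nbhs_filter z)); first exact: cvg_cst.
  exact: differentiable_continuous (dg z).
have [c _ cmax] := compact_EVT_max (ex_intro _ y Xy) cX (continuous_subspaceT cb).
apply: ub_le_sup; last by exists y.
exists (bregman g x c) => _ [z Xz <-]; apply: cmax.
by rewrite inE.
Qed.

End averages.

(** * The tail estimate at a fixed time and the resulting threshold *)

Theorem corollary4p7 (R : realType) :
  exists c q : R, [/\ 0 < c, 0 < q &
  forall (d : nat) (normX : 'rV[R]_d -> R) (X : set 'rV[R]_d)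
    (S : ptopologicalType)
    (Pi : 'rV[R]_d -> R.-pker borelType S ~> borelType S)
    (mu : 'rV[R]_d -> probability (borelType S) R)
    (F : 'rV[R]_d -> S -> R) (f : 'rV[R]_d -> R)
    (mirror : 'rV[R]_d -> R) (G Gt : 'rV[R]_d -> S -> 'rV[R]_d)
    (sigmaR L GG LPi : R)
    (dO : measure_display) (Omega : measurableType dO)
    (P : probability Omega R) (alpha : nat -> R) (x1 : 'rV[R]_d)
    (x : nat -> {RV P >-> borelType 'rV[R]_d})
    (s : nat -> {RV P >-> borelType S})
    (xstar : 'rV[R]_d) (epsilon p : R),
  let D := diameter normX X in
  let D1 := sup [set bregman mirror xstar y | y in X] in
  let z := weighted_average alpha x in
  let M := (epsilon ^+ 2)^-1 *
    Num.max (D1 ^+ 2 + GG ^+ 2 * D ^+ 2)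
      (Num.max
         ((GG ^+ 4 + GG ^+ 2 * (1 + 2 * LPi * D) ^+ 2) / sigmaR ^+ 2)
         (GG ^+ 2 * D ^+ 2 * ln (1 / p))) in
  is_norm normX -> compact X -> convex_set X ->
  (forall y, X y -> ergodic_unique_stationary (Pi y) (mu y)) ->
  (forall y, X y -> (mu y).-integrable setT (EFin \o F y)) ->
  (forall y, X y -> f y = \int[mu y]_t F y t) ->
  convex_function X f ->
  twice_continuously_differentiable mirror ->
  strongly_convex normX sigmaR mirror ->
  continuously_differentiable_on X f ->
  (forall y y', X y -> X y' ->
     dual_norm normX (grad f y - grad f y') <= L * normX (y - y')) ->
  jointly_measurable_on X G ->
  (forall y t, X y -> dual_norm normX (G y t) <= GG) ->
  (forall y, X y -> grad f y = vintegral (mu y) (G y)) ->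
  jointly_measurable_on X Gt ->
  (forall y t, X y ->
     G y t - vintegral (mu y) (G y) = Gt y t - vintegral (Pi y t) (Gt y)) ->
  (forall y t, X y -> dual_norm normX (Gt y t) <= GG) ->
  0 < LPi ->
  (forall y y' t, X y -> X y' ->
     dual_norm normX (Gt y t - Gt y' t) <= LPi * normX (y - y')) ->
  (forall n, (1 <= n)%N -> alpha n = 1 / Num.sqrt n%:R) ->
  stochastic_mirror_descent X mirror G Pi alpha x1 x s ->
  is_argmin X f xstar ->
  0 < epsilon -> 0 < p < 1 ->
  exists N : nat,
    is_least_threshold
      (fun n => (P [set w | (epsilon <= f (z n w) - f xstar)%R] <= p%:E)%E) N
    /\ N%:R <= c * (1 + M) * ln (2 + M) `^ q].
Proof.
pose k : R := 16 * 17.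
(* [k ^+ 4] is the constant of [log_threshold]; the extra 4 pays for rounding up to an integer, as
   [1 <= 4 * (1 + M) * ln (2 + M) ^+ 2]. *)
exists (k ^+ 4 + 4), 2; split => //.
  by rewrite ltr_wpDl// exprn_ge0// mulr_ge0.
move=> d N X S Pi mu F f g G Gt sigma L C K dO Omega P alpha x1 x s xs eps p D D1 z M.
move=> HN cX cvX _ _ _ cvf ctg scg [df cgf] _ mG GC grE mGt poisson GtC K0 GtK alphaE.
move=> [Xx1 x1E xmin law] [Xxs xsmin] eps0 /andP[p0 p1].
have s0 : 0 < sigma by case: scg.
have dg z' : differentiable g z' by case: ctg.
have C0 : 0 <= C by exact: le_trans (dual_norm_ge0 HN (G x1 point)) (GC _ _ Xx1).
have D0 : 0 <= D.
  rewrite /D; apply: le_trans (is_norm_le_diameter HN cX Xx1 Xx1).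
  by rewrite subrr is_norm0.
have l0 : 0 < ln (1 / p) by rewrite ln_gt0// ltr_pdivlMr// mul1r.
have M0 : 0 <= M.
  have h : 0 <= D1 ^+ 2 + C ^+ 2 * D ^+ 2.
    by apply: addr_ge0; [|apply: mulr_ge0]; exact: sqr_ge0.
  by apply: mulr_ge0; [rewrite invr_ge0 sqr_ge0|rewrite le_max h].
have xX n w : (1 <= n)%N -> X (x n w).
  by case: n => // -[_|n _]; [rewrite x1E|have [] := xmin n.+1 w isT].
have xargmin n w : (1 <= n)%N -> is_argmin X
    (fun y => dot (G (x n w) (s n w)) y + (alpha n)^-1 * bregman g y (x n w))
    (x n.+1 w) by exact: xmin.
have a0 n : (1 <= n)%N -> 0 < alpha n.
  by move=> n1; rewrite alphaE// divr_gt0// sqrtr_gt0 ltr0n.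
have amono n : (1 <= n)%N -> alpha n.+1 <= alpha n.
  move=> n1; rewrite !alphaE// !mul1r lef_pV2 ?posrE ?sqrtr_gt0 ?ltr0n//.
  by rewrite ler_wsqrtr// ler_nat.
have a2 n : (1 <= n)%N -> alpha n ^+ 2 = n%:R^-1.
  by move=> n1; rewrite alphaE// mul1r exprVn sqr_sqrtr.
have poisson' y t : X y -> G y t - grad f y = Gt y t - vintegral (Pi y t) (Gt y).
  by move=> Xy; rewrite grE// poisson.
have a0' n : (1 <= n)%N -> 0 <= alpha n by move=> n1; exact: ltW (a0 _ n1).
have Pfin n : (1 <= n)%N -> 256 * (1 + M) * (1 + ln n%:R) ^+ 2 <= n%:R ->
    (P [set w | (eps <= f (z n w) - f xs)%R] <= p%:E)%E.
  move=> n1 Mn.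
  set H := \sum_(1 <= k < n.+1) alpha k ^+ 2.
  have HT : H <= 1 + ln n%:R.
    apply: le_trans (harmonic_sum_le n1); apply: ler_sum_nat => i /andP[i1 _].
    by rewrite a2.
  have H0 : 0 <= H by apply: sumr_ge0 => i _; exact: sqr_ge0.
  have T1 : 1 <= 1 + ln (n%:R : R) by rewrite lerDl ln_ge0// ler1n.
  pose r : R := Num.sqrt n%:R.
  have r0 : 0 < r by rewrite sqrtr_gt0 ltr0n.
  have rn : r ^+ 2 = n%:R by rewrite sqr_sqrtr.
  have H0T : 0 <= H <= 1 + ln n%:R by rewrite H0.
  have [B1 B2] := @threshold_bounds R D1 D C sigma K (ln (1 / p)) eps H _ _ r
    s0 C0 D0 (ltW K0) eps0 H0T T1 (ltW r0) rn Mn.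
  set A := \sum_(1 <= k < n.+1) alpha k.
  have rA : r <= A.
    apply: (le_trans (sqrt_le_sum_inv_sqrt n)); apply: ler_sum_nat => i /andP[i1 _].
    by rewrite alphaE.
  have A0 : 0 < A by exact: lt_le_trans rA.
  (* A gap of [eps] forces the regret above [eps * r], since [r <= A]. The deterministic terms take
     at most half of it by [B1], so the martingale must reach [lam]. *)
  pose lam := eps * r / 2.
  have lam0 : 0 < lam by rewrite divr_gt0// mulr_gt0.
  pose S' w := \sum_(1 <= k < n.+1)
    alpha k * dot (noise (grad f) G Gt x s k w (s k.+1 w)) (xs - x k w).
  have sub : [set w | (eps <= f (z n w) - f xs)%R] `<=` [set w | (lam <= S' w)%R].
    move=> w /= ezf.
    have h1 : eps * r <= A * (f (z n w) - f xs).
      by rewrite mulrC ler_pM// ltW.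
    have h2 := @convex_average_gap_le R d X f alpha (fun k => x k w) xs n
      cvX cvf df a0 (fun k => xX k w) Xxs n1 A0.
    have h3 := @mirror_descent_sum_le R d N HN X g (fun k => x k w)
      (fun k => G (x k w) (s k w)) (fun k => Gt (x k w) (s k w))
      (fun k => Gt (x k w) (s k.+1 w)) (fun k => grad f (x k w))
      (fun k => noise (grad f) G Gt x s k w (s k.+1 w)) xs alpha sigma C K n
      cX cvX scg dg a0 amono (fun k => xX k w) Xxs (ltW K0)
      (fun k => xargmin k w) (fun k k1 => GC _ _ (xX k w k1))
      (fun k k1 => GtC _ _ (xX k w k1))
      (fun k k1 => GtK _ _ _ (xX k.+1 w isT) (xX k w k1)) (fun k k1 => erefl) n1.
    have h4 : bregman g xs (x 1%N w) <= D1.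
      exact: bregman_le_sup cX ctg (xX 1%N w isT).
    have a1 : alpha 1%N = 1 by rewrite alphaE// sqrtr1 divr1.
    move: h3; rewrite a1 -/H -/(S' w) -/D => h3.
    rewrite /lam; rewrite /z /weighted_average -/A in h1.
    move: h2; rewrite -/A => h2; lra.
  (* Comparing the probabilities of the two events requires both to be measurable, hence [z n] to be
     a random vector. *)
  have mz i : measurable_fun setT (fun w => z n w 0 i).
    rewrite /z /weighted_average -/A.
    have -> : (fun w => (A^-1 *: \sum_(1 <= k < n.+1) alpha k *: x k w) 0 i) =
        (fun w => A^-1 * \sum_(k < n) alpha k.+1 * x k.+1 w 0 i).
      apply/funext => w; rewrite mxE summxE big_add1/= big_mkord.
      by congr (_ * _); apply: eq_bigr => j _; rewrite mxE.
    apply: measurable_funM => //; apply: measurable_sum => j.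
    apply: measurable_funM => //.
    apply: (measurableT_comp (f := fun y : borelType 'rV[R]_d => y 0 i) (g := x j.+1)) => //.
    exact: coord_borel_measurable.
  have mfz : measurable_fun setT (fun w => f (z n w)).
    apply: (within_continuous_measurable_comp (X := X) (a := z n)).
    - by apply: compact_closed => //; exact: norm_hausdorff.
    - apply: continuous_in_subspaceT => y /[!inE] Xy.
      exact: differentiable_continuous (df _ Xy).
    - exact: measurable_fun_rV.
    - by move=> w; apply: convex_weighted_average => // j; exact: xX.
  have mS : measurable_fun setT S'.
    exact: (measurable_noise_sum (X := X)).
  have mge (h : Omega -> R) c : measurable_fun setT h -> measurable [set w | (c <= h w)%R].
    move=> mh; rewrite -[X in measurable X]setTI.
    apply: measurable_fun_le => //; exact: measurable_cst.
  have mzset : measurable [set w | (eps <= f (z n w) - f xs)%R].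
    by apply: mge; apply: measurable_funB.
  apply: (@le_trans _ _ (P [set w | (lam <= S' w)%R])).
    by apply: le_measure => //; rewrite inE//; exact: mge.
  pose t := 2 * ln (1 / p) / lam.
  have t0 : 0 < t by rewrite divr_gt0// mulr_gt0.
  have := @noise_tail R d S dO Omega P N X Pi (grad f) G Gt C alpha x s xs
    HN cX Xxs cgf mG mGt poisson' GtC xX law a0' n t lam t0.
  move=> /le_trans; apply; rewrite lee_fin.
  have -> : p = expR (- ln (1 / p)).
    by rewrite -lnV ?posrE ?divr_gt0// lnK ?posrE ?invr_gt0 ?divr_gt0// mul1r invrK.
  rewrite ler_expR.
  have -> : \sum_(1 <= k < n.+1) (alpha k * (2 * C * D)) ^+ 2 = H * (2 * C * D) ^+ 2.
    by rewrite mulr_suml; apply: eq_bigr => i _; rewrite exprMn.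
  apply: sub_gaussian_exponent => //.
  (* With [V = 4 C^2 D^2 H] the condition [8 l V <= lam^2] is [B2] divided by 4, whence its factor
     128. *)
  rewrite /lam; have -> : (eps * r / 2) ^+ 2 = eps ^+ 2 * n%:R / 4 by rewrite -rn; field.
  rewrite !exprMn; lra.
have L2 := ln_ge_half M0.
have M1 : 0 <= k ^+ 4 * (1 + M) * ln (2 + M) ^+ 2.
  apply: mulr_ge0; last exact: sqr_ge0.
  by apply: mulr_ge0; [exact/exprn_ge0/mulr_ge0|exact: addr_ge0].
pose m := (Num.truncn (k ^+ 4 * (1 + M) * ln (2 + M) ^+ 2)).+1.
have [n|N' HN' Nm] := @least_threshold_le
  (fun n => (P [set w | (eps <= f (z n w) - f xs)%R] <= p%:E)%E) m isT.
  move=> mn; apply: Pfin; first exact: leq_trans mn.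
  apply: (@log_threshold _ k) => //.
  rewrite ltW// (lt_le_trans (truncnS_gt _))// ler_nat.
  exact: mn.
exists N'; split => //.
rewrite (_ : ln (2 + M) `^ 2 = ln (2 + M) ^+ 2); last first.
  by rewrite powR_mulrn//; lra.
have : N'%:R <= k ^+ 4 * (1 + M) * ln (2 + M) ^+ 2 + 1.
  apply: (@le_trans _ _ m%:R); first by rewrite ler_nat.
  by rewrite /m -natr1 lerD2r truncn_le.
have : 1 / 4 <= (1 + M) * ln (2 + M) ^+ 2.
  have q1 : 1 / 4 <= ln (2 + M) ^+ 2 by rewrite expr2; nra.
  by rewrite (le_trans q1)// ler_peMl ?sqr_ge0// lerDl.
by move: (k ^+ 4) (ln (2 + M) ^+ 2) (1 + M) (N'%:R) => k4 l2 M' n'; lra.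
Qed.
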